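(* Let $\alpha\in[0,1)$ and $\beta=(\beta^1,\dots,\beta^m)\in[0,1)^m$. Consider the problem of minimizing $F(x)=\mathrm{CVaR}_\alpha[f_\omega(x)]$ over $x\in\mathbb{X}$ subject to $G^i(x)=\mathrm{CVaR}_{\beta^i}[g^i_\omega(x)]\le0$, $i=1,\dots,m$, with optimal value $p^{\mathrm{CVaR}}_\star$. Suppose: (a) $\|\nabla f_\omega(x)\|\le C_F$ and $\|\nabla g^i_\omega(x)\|\le C_G^i$ almost surely for all $x\in\mathbb{X}$ and each $i$; (b) $|g^i_\omega(x)|\le D_G^i$ for all $x\in\mathbb{X}$, almost surely, for each $i$; (c) the Lagrangian $\mathcal{L}(x,z)=F(x)+z^\top G(x)$ admits a saddle point $(x_\star,z_\star)\in\mathbb{X}\times\mathbb{R}^m_+$. Define $$P_2(\alpha,\beta)=\frac{16(C_F^2+1)}{(1-\alpha)^2}+2\left\|\mathrm{diag}(\mathbf{1}+\beta)\,\mathrm{diag}(\mathbf{1}-\beta)^{-1}D_G\right\|^2,\qquad P_3(\alpha,\beta)=16m\left\|\begin{pmatrix}\mathrm{diag}(\mathbf{1}-\beta)^{-1}C_G\\ \mathrm{diag}(\mathbf{1}-\beta)^{-1}\mathbf{1}\end{pmatrix}\right\|^2.$$ Run the primal-dual stochastic subgradient method on the reformulated problem $\mathcal{P}'$ (both defined in the context) with step sizes $\gamma_k=\gamma/\sqrt{K}$, $k=1,\dots,K$, where $0<\gamma<P_3(\alpha,\beta)^{-1/2}$. Then, with $\bar{x}_{K+1}=\frac{1}{K}\sum_{k=1}^K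 x_{k+1}$, $$\mathbb{E}\big[\mathrm{CVaR}_\alpha(f_\omega(\bar{x}_{K+1}))\big]-p^{\mathrm{CVaR}}_\star\le\frac{\eta(\alpha,\beta)}{\sqrt K},\qquad \mathbb{E}\big[\mathrm{CVaR}_{\beta^i}(g^i_\omega(\bar{x}_{K+1}))\big]\le\frac{\eta(\alpha,\beta)}{\sqrt K},\quad i=1,\dots,m,$$ where $\eta(\alpha,\beta)=\dfrac{P_1+\gamma^2P_2(\alpha,\beta)}{4\gamma(1-\gamma^2P_3(\alpha,\beta))}$ and $P_1$ is the constant of the context.
   Context: Setting. $\omega\in\Omega$ is random; $\mathbb{X}\subseteq\mathbb{R}^n$ is a closed convex set; the real-valued functions $f_\omega,g^1_\omega,\dots,g^m_\omega$ are convex (not necessarily differentiable) over $\mathbb{X}$, and $\mathbb{E}|f_\omega(x)|$, $\mathbb{E}|g^i_\omega(x)|$ are finite for every $x\in\mathbb{X}$. Write $G=(G^1,\dots,G^m)$, $C_G=(C_G^1,\dots,C_G^m)$, $D_G=(D_G^1,\dots,D_G^m)$. $\|\cdot\|$ is the Euclidean norm, $\mathbf{1}$ the all-ones vector, $\mathrm{diag}(v)$ the diagonal matrix with diagonal $v$, $[t]^+=\max\{t,0\}$, $\mathbb{R}_+$ the nonnegative reals. $\nabla h(x)$ denotes a subgradient of a convex function $h$ at $x$ (an arbitrary element of the subdifferential, assumed nonempty everywhere on $\mathbb{X}$ for $f_\omega$, $g^i_\omega$). CVaR. For $\delta\in[0,1)$ and a scalar random variable $y_\omega$, $\mathrm{CVaR}_\delta[y_\omega]=\min_{u\in\mathbb{R}}\{u+\frac{1}{1-\delta}\mathbb{E}[y_\omega-u]^+\}$.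 In $\mathrm{CVaR}_\alpha(f_\omega(\bar x_{K+1}))=F(\bar x_{K+1})$ and $\mathrm{CVaR}_{\beta^i}(g^i_\omega(\bar x_{K+1}))=G^i(\bar x_{K+1})$ the CVaR is with respect to $\omega$ with $\bar x_{K+1}$ held fixed; the outer expectation is over the samples that generate the iterates. Saddle point. $(x_\star,z_\star)$ is a saddle point of $\mathcal{L}$ if $\mathcal{L}(x_\star,z)\le\mathcal{L}(x_\star,z_\star)\le\mathcal{L}(x,z_\star)$ for all $(x,z)\in\mathbb{X}\times\mathbb{R}^m_+$. Reformulated problem $\mathcal{P}'$. For convex functions $h_\omega$ and $\delta\in[0,1)$ let $\psi^h_\omega(x,u;\delta)=u+\frac{1}{1-\delta}[h_\omega(x)-u]^+$. Let $\mathbb{U}=\{u\in\mathbb{R}^m: |u^i|\le D_G^i,\ i=1,\dots,m\}$. Problem $\mathcal{P}'$ is: minimize $\mathbb{E}[\psi^f_\omega(x,u^0;\alpha)]$ over $(x,u^0,u)\in\mathbb{X}\times\mathbb{R}\times\mathbb{U}$ subject to $\mathbb{E}[\psi^{g^i}_\omega(x,u^i;\beta^i)]\le0$, $i=1,\dots,m$. Algorithm on $\mathcal{P}'$. Write $w=(x,u^0,u)$, $\mathbb{W}=\mathbb{X}\times\mathbb{R}\times\mathbb{U}$, $\phi_\omega(w)=\psi^f_\omega(x,u^0;\alpha)$, $\theta^i_\omega(w)=\psi^{g^i}_\omega(x,u^i;\beta^i)$, $\theta_\omega=(\theta^1_\omega,\dots,\theta^m_\omega)$. Choose $w_1=(x_1,u^0_1,u_1)\in\mathbb{W}$,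 $z_1=0\in\mathbb{R}^m$. All samples $\omega_1,\omega_{1+1/2},\omega_2,\omega_{2+1/2},\dots$ are i.i.d. with the law of $\omega$. For $k\ge1$: sample $\omega_k$ and set $$w_{k+1}=\operatorname*{argmin}_{w\in\mathbb{W}}\Big\langle\nabla\phi_{\omega_k}(w_k)+\sum_{i=1}^m z_k^i\nabla\theta^i_{\omega_k}(w_k),\,w-w_k\Big\rangle+\frac{1}{2\gamma_k}\|w-w_k\|^2;$$ then sample $\omega_{k+1/2}$ and set $$z_{k+1}=\operatorname*{argmax}_{z\in\mathbb{R}^m_+}\langle\theta_{\omega_{k+1/2}}(w_{k+1}),\,z-z_k\rangle-\frac{1}{2\gamma_k}\|z-z_k\|^2.$$ $x_k$ denotes the $x$-component of $w_k$. Constant $P_1$. Let $u^0_\star$ be a minimizer of $u^0\mapsto\mathbb{E}[\psi^f_\omega(x_\star,u^0;\alpha)]$ over $\mathbb{R}$ and let $u_\star\in\mathbb{U}$ be such that each $u^i_\star$ is a minimizer of $u^i\mapsto\mathbb{E}[\psi^{g^i}_\omega(x_\star,u^i;\beta^i)]$ over $\mathbb{R}$. Put $w_\star=(x_\star,u^0_\star,u_\star)$ and $P_1=2\|w_1-w_\star\|^2+4\|\mathbf{1}+z_\star\|^2$. *)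

(* Defs.v *)
From HB Require Import structures.
From mathcomp Require Import all_boot all_order all_algebra.
From mathcomp Require Import all_classical all_reals all_analysis.

Set Implicit Arguments.
Unset Strict Implicit.
Unset Printing Implicit Defensive.

Import Order.TTheory GRing.Theory Num.Theory.
Import numFieldNormedType.Exports.

Local Open Scope classical_set_scope.
Local Open Scope ring_scope.

(* MathComp-Analysis; random variables over an arbitrary [R : realType].
   The library norm on matrices is the sup norm, hence [enorm]. *)

Definition dotv (R : realType) (N : nat) (u v : 'cV[R]_N) : R :=
  \sum_(i < N) u i 0 * v i 0.

Definition enorm (R : realType) (N : nat) (u : 'cV[R]_N) : R :=
  Num.sqrt (dotv u u).

Definition nonneg (R : realType) (m : nat) : set 'cV[R]_m :=
  [set z | forall i, 0 <= z i 0].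

Definition is_argmin (R : realType) (V : Type) (A : set V) (J : V -> R) (v : V) :=
  A v /\ forall v', A v' -> J v <= J v'.

Definition is_argmax (R : realType) (V : Type) (A : set V) (J : V -> R) (v : V) :=
  A v /\ forall v', A v' -> J v' <= J v.

(* Subdifferential at [x] of a function whose effective domain is [E]: the
   subgradient inequality is required on [E] only. *)
Definition subdiff (R : realType) (N : nat) (E : set 'cV[R]_N)
    (h : 'cV[R]_N -> R) (x : 'cV[R]_N) : set 'cV[R]_N :=
  [set s | forall y, E y -> h x + dotv s (y - x) <= h y].

(* [inf] instead of [min]: for [delta = 0] the infimum, which is then the mean,
   need not be attained. *)
Definition cvar (d : measure_display) (Omega : measurableType d) (R : realType)
    (P : probability Omega R) (delta : R) (y : Omega -> R) : R :=
  inf (range (fun u : R =>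
    u + (1 - delta)^-1 * fine ('E_P[(fun o => Num.max (y o - u) 0)%R])%E)).

Definition is_saddle_point (R : realType) (n m : nat) (X : set 'cV[R]_n)
    (L : 'cV[R]_n -> 'cV[R]_m -> R) (xs : 'cV[R]_n) (zs : 'cV[R]_m) :=
  [/\ X xs, nonneg zs &
    forall x z, X x -> nonneg z -> L xs z <= L xs zs /\ L xs zs <= L x zs].

Definition psi (R : realType) (n : nat) (h : 'cV[R]_n -> R)
    (x : 'cV[R]_n) (u delta : R) : R :=
  u + (1 - delta)^-1 * Num.max (h x - u) 0.

(* A point w = (x, u0, u) of R^n x R x R^m is one column vector, so that [dotv]
   and [enorm] are the inner product and norm of the product space. *)
Definition mkw (R : realType) (n m : nat) (x : 'cV[R]_n) (u0 : R)
    (u : 'cV[R]_m) : 'cV[R]_(n + 1 + m) := col_mx (col_mx x u0%:M) u.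

Definition wx (R : realType) (n m : nat) (w : 'cV[R]_(n + 1 + m)) : 'cV[R]_n :=
  usubmx (usubmx w).

Definition wu0 (R : realType) (n m : nat) (w : 'cV[R]_(n + 1 + m)) : R :=
  dsubmx (usubmx w) 0 0.

Definition wu (R : realType) (n m : nat) (w : 'cV[R]_(n + 1 + m)) : 'cV[R]_m :=
  dsubmx w.

Definition Uset (R : realType) (m : nat) (DG : 'cV[R]_m) : set 'cV[R]_m :=
  [set u | forall i, `|u i 0| <= DG i 0].

Definition Wset (R : realType) (n m : nat) (X : set 'cV[R]_n) (DG : 'cV[R]_m) :
    set 'cV[R]_(n + 1 + m) :=
  [set w | X (wx w) /\ Uset DG (wu w)].

Definition phi (R : realType) (n m : nat) (h : 'cV[R]_n -> R) (alpha : R)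
    (w : 'cV[R]_(n + 1 + m)) : R :=
  psi h (wx w) (wu0 w) alpha.

Definition theta (R : realType) (n m : nat) (h : 'I_m -> 'cV[R]_n -> R)
    (beta : 'cV[R]_m) (i : 'I_m) (w : 'cV[R]_(n + 1 + m)) : R :=
  psi (h i) (wx w) (wu w i 0) (beta i 0).

(* One primal-dual step from (w, z) to (w', z'): [ph], [th] are the objective
   and the constraints at the first sample, [th'] the constraints at the second
   one. [E] is the common domain of [ph] and [th i], used for their
   subgradients, which are arbitrary. *)
Definition primal_step (R : realType) (N m : nat) (E W : set 'cV[R]_N)
    (ph : 'cV[R]_N -> R) (th : 'I_m -> 'cV[R]_N -> R) (gam : R)
    (w : 'cV[R]_N) (z : 'cV[R]_m) (w' : 'cV[R]_N) :=
  exists (s0 : 'cV[R]_N) (s : 'I_m -> 'cV[R]_N),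
    [/\ subdiff E ph w s0, forall i, subdiff E (th i) w (s i) &
      is_argmin W (fun v => dotv (s0 + \sum_(i < m) z i 0 *: s i) (v - w)
                            + (2 * gam)^-1 * enorm (v - w) ^+ 2) w'].

Definition dual_step (R : realType) (N m : nat) (th' : 'I_m -> 'cV[R]_N -> R)
    (gam : R) (w' : 'cV[R]_N) (z z' : 'cV[R]_m) :=
  is_argmax (@nonneg R m) (fun v => dotv (\col_i th' i w') (v - z)
                            - (2 * gam)^-1 * enorm (v - z) ^+ 2) z'.

(* i.i.d. sequence of random elements with law [P]; independence is the product
   rule over finite subfamilies. *)
Definition iid (dO dT : measure_display) (Omega : measurableType dO)
    (T : measurableType dT) (R : realType) (P : probability Omega R)
    (Q : probability T R) (xi : nat -> T -> Omega) :=
  [/\ forall j, measurable_fun setT (xi j),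
      forall j A, measurable A -> Q (xi j @^-1` A) = P A &
      forall (J : seq nat) (A : nat -> set Omega),
        uniq J -> (forall j, measurable (A j)) ->
        Q (\big[setI/setT]_(j <- J) (xi j @^-1` A j)) =
        (\big[mule/1%E]_(j <- J) Q (xi j @^-1` A j))%E].

(* Samples have half-integer times: [om j] is omega_{j/2}, so omega_k is
   [om k.*2], omega_{k+1/2} is [om k.*2.+1], and the first sample omega_1 is
   [om 2]; [om 0] and [om 1] are unused. [past om k] is the sigma-algebra of
   the samples omega_1, omega_{1+1/2}, ..., omega_{k-1+1/2}. *)
Definition past (dO dT : measure_display) (Omega : measurableType dO)
    (T : measurableType dT) (om : nat -> T -> Omega) (k : nat) : set (set T) :=
  <<s [set S | exists j A, [/\ (2 <= j < k.*2)%N, measurable A & S = om j @^-1` A]] >>.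

Definition adapted (dO dT : measure_display) (Omega : measurableType dO)
    (T : measurableType dT) (R : realType) (om : nat -> T -> Omega) (K N : nat)
    (v : nat -> T -> 'cV[R]_N) :=
  forall k (i : 'I_N) (B : set R), (1 <= k <= K.+1)%N -> measurable B ->
    past om k ((fun t => v k t i 0) @^-1` B).

(* [K] steps of the method on the reformulated problem. Given the history, a
   subgradient may be chosen in any way that does not look at future samples:
   this, and the measurability of the iterates, is what [adapted] says. *)
Definition primal_dual_run (dO dT : measure_display) (Omega : measurableType dO)
    (T : measurableType dT) (R : realType) (n m K : nat)
    (D X : set 'cV[R]_n) (f : Omega -> 'cV[R]_n -> R)
    (g : Omega -> 'I_m -> 'cV[R]_n -> R) (alpha : R) (beta DG : 'cV[R]_m)
    (gam : nat -> R) (om : nat -> T -> Omega) (w1 : 'cV[R]_(n + 1 + m))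
    (w : nat -> T -> 'cV[R]_(n + 1 + m)) (z : nat -> T -> 'cV[R]_m) :=
  [/\ Wset X DG w1,
      forall t, w 1%N t = w1 /\ z 1%N t = 0,
      adapted om K w /\ adapted om K z &
      forall k t, (1 <= k <= K)%N ->
        primal_step [set v | D (wx v)] (Wset X DG)
          (phi (f (om k.*2 t)) alpha) (theta (g (om k.*2 t)) beta)
          (gam k) (w k t) (z k t) (w k.+1 t) /\
        dual_step (theta (g (om k.*2.+1 t)) beta)
          (gam k) (w k.+1 t) (z k t) (z k.+1 t)].

Definition const_P1 (R : realType) (n m : nat) (w1 ws : 'cV[R]_(n + 1 + m))
    (zs : 'cV[R]_m) : R :=
  2 * enorm (w1 - ws) ^+ 2 + 4 * enorm (const_mx 1 + zs) ^+ 2.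

Definition const_P2 (R : realType) (m : nat) (alpha CF : R)
    (beta DG : 'cV[R]_m) : R :=
  16 * (CF ^+ 2 + 1) / (1 - alpha) ^+ 2
  + 2 * enorm (diag_mx (const_mx 1 + beta)^T
               *m invmx (diag_mx (const_mx 1 - beta)^T) *m DG) ^+ 2.

Definition const_P3 (R : realType) (m : nat) (beta CG : 'cV[R]_m) : R :=
  16 * m%:R * enorm (col_mx (invmx (diag_mx (const_mx 1 - beta)^T) *m CG)
                            (invmx (diag_mx (const_mx 1 - beta)^T)
                             *m (const_mx 1 : 'cV[R]_m))) ^+ 2.

(* Main.v *)
Require Import Defs.
From HB Require Import structures.
From mathcomp Require Import all_boot all_order all_algebra.
From mathcomp Require Import all_classical all_reals all_analysis.
From mathcomp Require Import measurable_realfun zify ring lra.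

Set Implicit Arguments.
Unset Strict Implicit.
Unset Printing Implicit Defensive.

Import Order.TTheory GRing.Theory Num.Theory.
Import numFieldNormedType.Exports.

Local Open Scope classical_set_scope.
Local Open Scope ring_scope.

(* The method is a primal-dual subgradient scheme for the saddle function
   L(w, z) = E[phi(w)] + z . E[theta(w)], w = (x, u0, u). Every subgradient of phi is bounded by
   sqrt(CF^2 + 1) / (1 - alpha), similarly for theta, and theta is bounded on W. The three-point
   inequalities of the two proximal steps, taken in expectation against the comparison point
   (w_star, z), telescope to
     2 gam sum_k E[L(w_(k+1), z) - L(w_star, z_k)]
       <= |w_1 - w_star|^2 + |z|^2 + K gam^2 P2 / 2 + (P3 gam^2 / 2) sum_k (E|z_k|^2 + |z|^2).
   With z = z_star the left side is nonnegative, which bounds E|z_k|^2 uniformly (with the stated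
   constant if one uses max(z_star, z_k) <= z_star + |z_k - z_star|); then z = 0 gives the
   optimality gap and z = z_star + e_i the i-th constraint violation, by convexity (Jensen)
   and because CVaR is the infimum over the auxiliary variable.

   [adapted] only makes w_(k+1) measurable with respect to the past up to and including
   omega_(k+1/2), since the choice of a subgradient may depend on that sample; so
   theta_(omega_(k+1/2)) is unbiased at w_k but not at w_(k+1), and the difference is absorbed by
   the Lipschitz bound within the same constants. *)

(** * Euclidean geometry and one deterministic step *)

(** Three obstacles shape the development. The bounds (a) and (b) hold only off a null set, and
    iterates are measurable only coordinate by coordinate. So the bounds are imposed on one event of
    full probability, the integrands are cut off outside it, and measurability of composites is
    drawn from Lipschitz continuity. Next, [u0] ranges over all of R and [f] is merely integrable,
    so only differences of phi are controlled. Integrability comes from a crude pathwise bound on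
    the iterates, valid because each step moves by an amount bounded in terms of the current
    multiplier. Finally, no conditional expectation is used: the past is a sub-sigma-algebra on the
    sample space, and a fresh sample is averaged out by a product law and Fubini.

    The noise of a step grows with |z_k|^2, so the bound on E|z_k|^2 appears on both sides of its
    own recursion. The condition gamma^2 P3 < 1 is what closes this loop, and solving it puts 1 -
    gamma^2 P3 in the denominator of eta. The terms C^2 + 1 in P2 and P3 join a slope C in x with a
    slope 1 in the auxiliary variable, both scaled by 1 / (1 - delta). *)

Section euclidean.
Context {R : realType} {N : nat}.
Implicit Types (u v w : 'cV[R]_N) (a : R).

Lemma dotvC u v : dotv u v = dotv v u.
Proof. by apply: eq_bigr => i _; rewrite mulrC. Qed.

Lemma dotvDl u v w : dotv (u + v) w = dotv u w + dotv v w.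
Proof. by rewrite -big_split; apply: eq_bigr => i _; rewrite mxE mulrDl. Qed.

Lemma dotvZl a u v : dotv (a *: u) v = a * dotv u v.
Proof. by rewrite mulr_sumr; apply: eq_bigr => i _; rewrite mxE mulrA. Qed.

Lemma dotvNl u v : dotv (- u) v = - dotv u v.
Proof. by rewrite -scaleN1r dotvZl mulN1r. Qed.

Lemma dotvBl u v w : dotv (u - v) w = dotv u w - dotv v w.
Proof. by rewrite dotvDl dotvNl. Qed.

Lemma dotvDr u v w : dotv u (v + w) = dotv u v + dotv u w.
Proof. by rewrite dotvC dotvDl !(dotvC u). Qed.

Lemma dotvZr a u v : dotv u (a *: v) = a * dotv u v.
Proof. by rewrite dotvC dotvZl dotvC. Qed.

Lemma dotvNr u v : dotv u (- v) = - dotv u v.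
Proof. by rewrite dotvC dotvNl dotvC. Qed.

Lemma dotvBr u v w : dotv u (v - w) = dotv u v - dotv u w.
Proof. by rewrite dotvDr dotvNr. Qed.

Lemma dotv0r u : dotv u 0 = 0.
Proof. by rewrite /dotv big1// => i _; rewrite mxE mulr0. Qed.

Lemma dotv0l u : dotv 0 u = 0.
Proof. by rewrite dotvC dotv0r. Qed.

Lemma dotv_suml (I : Type) (r : seq I) (F : I -> 'cV[R]_N) v :
  dotv (\sum_(i <- r) F i) v = \sum_(i <- r) dotv (F i) v.
Proof.
by elim/big_rec2: _ => [|i x y _ <-]; rewrite ?dotv0l ?dotvDl.
Qed.

Lemma dotvv_ge0 u : 0 <= dotv u u.
Proof. by apply: sumr_ge0 => i _; rewrite -expr2 sqr_ge0. Qed.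

Lemma enorm_sqr u : enorm u ^+ 2 = dotv u u.
Proof. by rewrite sqr_sqrtr// dotvv_ge0. Qed.

Lemma enorm_ge0 u : 0 <= enorm u.
Proof. exact: sqrtr_ge0. Qed.

Lemma enorm0 : enorm (0 : 'cV[R]_N) = 0.
Proof. by rewrite /enorm dotv0r sqrtr0. Qed.

Lemma enormN u : enorm (- u) = enorm u.
Proof. by rewrite /enorm dotvNl dotvNr opprK. Qed.

Lemma enormC u v : enorm (u - v) = enorm (v - u).
Proof. by rewrite -enormN opprB. Qed.

Lemma enormZ a u : enorm (a *: u) = `|a| * enorm u.
Proof.
by rewrite /enorm dotvZl dotvZr mulrA -expr2 sqrtrM ?sqr_ge0// sqrtr_sqr.
Qed.

Lemma dotvv_eq0 u : dotv u u = 0 -> u = 0.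
Proof.
move=> /eqP; rewrite psumr_eq0 => [/allP u0|i _]; last by rewrite -expr2 sqr_ge0.
apply/matrixP => i j; rewrite mxE (ord1 j).
have := u0 i (mem_index_enum _); rewrite -expr2 expf_eq0/= => /eqP; exact.
Qed.

Lemma dotv_le u v : dotv u v <= enorm u * enorm v.
Proof.
have [->|v0] := eqVneq v 0.
  by rewrite dotv0r mulr_ge0 ?enorm_ge0.
have c0 : 0 < dotv v v.
  rewrite lt_neqAle dotvv_ge0 andbT eq_sym; apply: contra_neq v0.
  exact: dotvv_eq0.
have := dotvv_ge0 (dotv v v *: u - dotv u v *: v).
rewrite !(dotvBl, dotvBr, dotvZl, dotvZr) (dotvC v u) => h.
have {}h : dotv u v ^+ 2 <= dotv u u * dotv v v by nra.
rewrite -sqrtrM ?dotvv_ge0//; apply: le_trans (ler_norm _) _.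
by rewrite -sqrtr_sqr ler_wsqrtr.
Qed.

Lemma dotv_ge u v : - (enorm u * enorm v) <= dotv u v.
Proof. by rewrite lerNl -dotvNl -(enormN u) dotv_le. Qed.

Lemma enormD u v : enorm (u + v) <= enorm u + enorm v.
Proof.
rewrite -(@ler_pXn2r _ 2)// ?nnegrE ?addr_ge0 ?enorm_ge0//.
rewrite sqrrD !enorm_sqr !(dotvDl, dotvDr) (dotvC v u).
have := dotv_le u v; lra.
Qed.

Lemma enormB u v : enorm (u - v) <= enorm u + enorm v.
Proof. by rewrite -[enorm v]enormN enormD. Qed.

Lemma le_enormB u v : enorm u - enorm v <= enorm (u - v).
Proof. by rewrite lerBlDr -{1}(subrK v u) enormD. Qed.

Lemma enorm_sum (I : Type) (r : seq I) (F : I -> 'cV[R]_N) :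
  enorm (\sum_(i <- r) F i) <= \sum_(i <- r) enorm (F i).
Proof.
elim/big_rec2: _ => [|i x y _ h]; first by rewrite enorm0.
by apply: le_trans (enormD _ _) _; rewrite lerD2l.
Qed.

Lemma enorm_le_l1 u : enorm u <= \sum_(i < N) `|u i 0|.
Proof.
have s0 : 0 <= \sum_(i < N) `|u i 0| by apply: sumr_ge0.
rewrite -(@ler_pXn2r _ 2)// ?nnegrE ?enorm_ge0//.
rewrite enorm_sqr expr2 mulr_suml; apply: ler_sum => i _.
rewrite -expr2 -real_normK ?num_real// expr2.
by rewrite ler_wpM2l// (bigD1 i)//= lerDl sumr_ge0.
Qed.

Lemma coord_le_enorm u i : `|u i 0| <= enorm u.
Proof.
rewrite -(@ler_pXn2r _ 2)// ?nnegrE ?enorm_ge0//.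
rewrite enorm_sqr real_normK ?num_real// /dotv (bigD1 i)//= -expr2.
by rewrite lerDl sumr_ge0// => j _; rewrite -expr2 sqr_ge0.
Qed.

Lemma enorm_sqrE u : enorm u ^+ 2 = \sum_(i < N) u i 0 ^+ 2.
Proof. by rewrite enorm_sqr; apply: eq_bigr => i _; rewrite expr2. Qed.

End euclidean.

Lemma sum_mul_sqr_le (R : realType) (N : nat) (x y : 'I_N -> R) :
  (\sum_i x i * y i) ^+ 2 <= (\sum_i x i ^+ 2) * \sum_i y i ^+ 2.
Proof.
pose u : 'cV[R]_N := \col_i x i; pose v : 'cV[R]_N := \col_i y i.
have -> : \sum_i x i * y i = dotv u v by apply: eq_bigr => i _; rewrite !mxE.
have -> : \sum_i x i ^+ 2 = enorm u ^+ 2.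
  by rewrite enorm_sqrE; apply: eq_bigr => i _; rewrite !mxE.
have -> : \sum_i y i ^+ 2 = enorm v ^+ 2.
  by rewrite enorm_sqrE; apply: eq_bigr => i _; rewrite !mxE.
rewrite -exprMn -real_normK ?num_real// ler_pXn2r// ?nnegrE ?mulr_ge0 ?enorm_ge0//.
by rewrite ler_norml dotv_le dotv_ge.
Qed.

(** * Three-point inequalities for proximal steps *)

Section proximal_step.
Context {R : realType}.

Definition segment_closed (N : nat) (A : set 'cV[R]_N) :=
  forall x y s, A x -> A y -> 0 <= s <= 1 -> A (x + s *: (y - x)).

Lemma ge0_of_small_slope (a b : R) :
  (forall s, 0 < s <= 1 -> 0 <= a + s * b) -> 0 <= a.
Proof.
move=> h; rewrite leNgt; apply/negP => a0.
(* Chosen so that s |b| < - a; this replaces the limit s -> 0. *)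
pose s := - a / (- a + `|b| + 1).
have d0 : 0 < - a + `|b| + 1 by have := normr_ge0 b; lra.
have s0 : 0 < s by rewrite divr_gt0// oppr_gt0.
have s1 : s <= 1 by rewrite ler_pdivrMr// mul1r; have := normr_ge0 b; lra.
have := h s; rewrite s0 s1 => /(_ isT).
have : s * b < - a; last by lra.
apply: le_lt_trans (_ : s * `|b| < _); first by rewrite ler_pM2l// ler_norm.
rewrite /s mulrAC ltr_pdivrMr//.
rewrite ltr_pM2l ?oppr_gt0//; lra.
Qed.

(** First-order optimality of [w'] along the segment to [v]: the one-sided derivative at s = 0 is
    nonnegative, and expanding |d + e|^2 turns this into the inequality. *)
Lemma prox_three_point (N : nat) (A : set 'cV[R]_N) (p w w' v : 'cV[R]_N) (gam : R) :
  0 < gam -> segment_closed A -> A v ->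
  is_argmin A (fun v => dotv p (v - w) + (2 * gam)^-1 * enorm (v - w) ^+ 2) w' ->
  2 * gam * dotv p (w' - v) + enorm (v - w') ^+ 2 + enorm (w' - w) ^+ 2
    <= enorm (v - w) ^+ 2.
Proof.
move=> g0 cA Av [Aw' hmin].
have g2 : 0 < 2 * gam by lra.
have [d dE] : exists d, d = v - w' by exists (v - w').
have [e eE] : exists e, e = w' - w by exists (w' - w).
have key : 0 <= 2 * gam * dotv p d + 2 * dotv d e.
  apply: (@ge0_of_small_slope _ (dotv d d)) => s /andP[s0 s1].
  have := hmin _ (cA _ _ s Aw' Av _); rewrite ltW// => /(_ s1).
  rewrite -dE addrAC -eE.
  rewrite !enorm_sqr !(dotvDl, dotvDr, dotvZl, dotvZr) (dotvC e d) => h.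
  have {}h : 0 <= s * dotv p d
      + (2 * gam)^-1 * (2 * s * dotv d e + s ^+ 2 * dotv d d) by lra.
  have := mulr_ge0 (ltW g2) h.
  rewrite mulrDr (mulrA _ _^-1) divff ?gt_eqF// mul1r => {}h.
  rewrite -(pmulr_rge0 _ s0).
  by apply: le_trans h _; rewrite le_eqVlt; apply/orP; left; apply/eqP; ring.
rewrite -dE -eE.
have -> : v - w = d + e by rewrite dE eE addrA subrK.
have -> : w' - v = - d by rewrite dE opprB.
rewrite !enorm_sqr dotvNr !(dotvDl, dotvDr) (dotvC e d); lra.
Qed.

Lemma ascent_three_point (m : nat) (A : set 'cV[R]_m) (p z z' v : 'cV[R]_m) (gam : R) :
  0 < gam -> segment_closed A -> A v ->
  is_argmax A (fun v => dotv p (v - z) - (2 * gam)^-1 * enorm (v - z) ^+ 2) z' ->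
  2 * gam * dotv p (v - z') + enorm (v - z') ^+ 2 + enorm (z' - z) ^+ 2
    <= enorm (v - z) ^+ 2.
Proof.
move=> g0 cA Av [Az' hmax].
rewrite -(opprB z' v) dotvNr -dotvNl opprB.
apply: (@prox_three_point _ A) => //; split => // v' /hmax; rewrite !dotvNl; lra.
Qed.

Lemma segment_closed_nonneg (m : nat) : segment_closed (@nonneg R m).
Proof.
move=> x y s x0 y0 /andP[s0 s1] i; rewrite !mxE.
have := x0 i; have := y0 i; nra.
Qed.

End proximal_step.

(** * One primal-dual step, pathwise *)

Section step.
Context {R : realType} {N m : nat}.
Variables (E W : set 'cV[R]_N) (gam Cp : R) (Ct Dt : 'I_m -> R).
Hypotheses (g0 : 0 < gam) (cW : segment_closed W) (WE : W `<=` E).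

Let Ct2 := \sum_i Ct i ^+ 2.
Let Dt2 := \sum_i Dt i ^+ 2.

Lemma enorm_lincomb_le (s0 : 'cV[R]_N) (s : 'I_m -> 'cV[R]_N) (z : 'cV[R]_m) :
  nonneg z -> enorm s0 <= Cp -> (forall i, enorm (s i) <= Ct i) ->
  enorm (s0 + \sum_(i < m) z i 0 *: s i) <= Cp + \sum_i z i 0 * Ct i.
Proof.
move=> z0 hs0 hs; apply: le_trans (enormD _ _) _; apply: lerD => //.
apply: le_trans (enorm_sum _ _) _; apply: ler_sum => i _.
by rewrite enormZ ger0_norm ?z0// ler_wpM2l// z0.
Qed.

Section one_step.
Variables (ph : 'cV[R]_N -> R) (th th' : 'I_m -> 'cV[R]_N -> R).
Variables (w w' : 'cV[R]_N) (z z' : 'cV[R]_m).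
Hypotheses (Ww : W w) (z_ge0 : nonneg z).
Hypothesis ph_sub : forall s, subdiff E ph w s -> enorm s <= Cp.
Hypothesis th_sub : forall i s, subdiff E (th i) w s -> enorm s <= Ct i.
Hypothesis th'_bnd : forall i x, W x -> `|th' i x| <= Dt i.
Hypothesis primal : primal_step E W ph th gam w z w'.
Hypothesis dual : dual_step th' gam w' z z'.

Lemma primal_step_mem : W w'.
Proof. by case: primal => s0 [s [_ _ []]]. Qed.

Lemma dual_step_mem : nonneg z'.
Proof. by case: dual. Qed.

(** Taking [v = w] in the three-point inequality leaves |w' - w|^2 <= gam <p, w - w'>. This and its
    dual analogue later bound the iterates pathwise. *)
Lemma primal_step_move :
  enorm (w' - w) <= gam * (Cp + \sum_i z i 0 * Ct i).
Proof.
case: primal => s0 [s [hs0 hs am]].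
have := prox_three_point g0 cW Ww am.
have := enorm_lincomb_le z_ge0 (ph_sub hs0) (fun i => th_sub (hs i)).
set p := _ + \sum_(_ < _) _; set B := Cp + _ => hp.
have := dotv_ge p (w' - w); rewrite (enormC w w') subrr enorm0 expr0n/=.
have := enorm_ge0 (w' - w); set x := enorm (w' - w) => x0 h1 h2.
have [->|xn0] := eqVneq x 0; first by rewrite mulr_ge0 ?(ltW g0)// (le_trans _ hp) ?enorm_ge0.
have {}x0 : 0 < x by rewrite lt_neqAle eq_sym xn0.
rewrite -(ler_pM2r x0).
have : gam * - dotv p (w' - w) <= gam * (B * x).
  rewrite ler_pM2l// lerNl; apply: le_trans h1.
  by rewrite lerN2 ler_pM2r.
lra.
Qed.

Lemma dual_step_map_sqr : enorm (\col_i th' i w') ^+ 2 <= Dt2.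
Proof.
rewrite enorm_sqrE; apply: ler_sum => i _; rewrite mxE.
rewrite -real_normK ?num_real// ler_pXn2r ?nnegrE//.
  exact/th'_bnd/primal_step_mem.
exact/(le_trans _ (th'_bnd i primal_step_mem)).
Qed.

Lemma dual_step_move : enorm (z' - z) <= gam * Num.sqrt Dt2.
Proof.
have := ascent_three_point g0 (@segment_closed_nonneg R m) z_ge0 dual.
have : enorm (\col_i th' i w') <= Num.sqrt Dt2.
  by rewrite ler_wsqrtr// -enorm_sqr dual_step_map_sqr.
set p := \col_i _ => hp.
have := dotv_ge p (z - z'); rewrite (enormC z z') subrr enorm0 expr0n/=.
have := enorm_ge0 (z' - z); set x := enorm (z' - z) => x0 h1 h2.
have [->|xn0] := eqVneq x 0; first by rewrite mulr_ge0 ?(ltW g0)// sqrtr_ge0.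
have {}x0 : 0 < x by rewrite lt_neqAle eq_sym xn0.
rewrite -(ler_pM2r x0).
have : gam * - dotv p (z - z') <= gam * (Num.sqrt Dt2 * x).
  rewrite ler_pM2l// lerNl; apply: le_trans h1.
  by rewrite lerN2 ler_pM2r.
lra.
Qed.

Section step_gap.
Variables (Ph : 'cV[R]_N -> R) (Th : 'I_m -> 'cV[R]_N -> R).
Variables (ws : 'cV[R]_N) (z0 : 'cV[R]_m).
Hypotheses (Wws : W ws) (z0_ge0 : nonneg z0).
Hypothesis th'_lip : forall i x y, W x -> W y ->
  `|th' i x - th' i y| <= Ct i * enorm (x - y).
Hypothesis Ph_lip : forall x y, W x -> W y -> `|Ph x - Ph y| <= Cp * enorm (x - y).
Hypothesis Th_lip : forall i x y, W x -> W y ->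
  `|Th i x - Th i y| <= Ct i * enorm (x - y).

(* The dual sample is compared at [w], not at [w']: [w'] need not be independent
   of it. The three error terms add up because z + z0 + |z0 - z| = 2 max(z0, z). *)
Lemma step_gap :
  2 * gam * (ph w - ph ws + \sum_i z i 0 * (th i w - th i ws)
             + \sum_i (z0 i 0 - z i 0) * th' i w)
  + 2 * gam * (Ph w' - Ph w + \sum_i z0 i 0 * (Th i w' - Th i w))
  + enorm (ws - w') ^+ 2 + enorm (z0 - z') ^+ 2
  <= enorm (ws - w) ^+ 2 + enorm (z0 - z) ^+ 2 + gam ^+ 2 * Dt2
     + 8 * gam ^+ 2 * Cp ^+ 2
     + 8 * gam ^+ 2 * Ct2 * \sum_i Num.max (z0 i 0) (z i 0) ^+ 2.
Proof.
have Ww' := primal_step_mem.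
set dl := enorm (w' - w).
have dl0 : 0 <= dl := enorm_ge0 _.
pose S := \sum_i Num.max (z0 i 0) (z i 0) * Ct i.
have hS : S ^+ 2 <= (\sum_i Num.max (z0 i 0) (z i 0) ^+ 2) * Ct2.
  exact: sum_mul_sqr_le.
case: primal => s0 [s [hs0 hs am]].
have := prox_three_point g0 cW Wws am.
set p := s0 + _ => h3.
have hp1 : ph w - ph ws + \sum_i z i 0 * (th i w - th i ws) <= dotv p (w - ws).
  rewrite /p dotvDl dotv_suml; apply: lerD.
    by have := hs0 _ (WE Wws); rewrite -(opprB w ws) dotvNr; lra.
  apply: ler_sum => i _; rewrite dotvZl ler_wpM2l ?z_ge0//.
  by have := hs i _ (WE Wws); rewrite -(opprB w ws) dotvNr; lra.
have hp2 : - ((Cp + \sum_i z i 0 * Ct i) * dl) <= dotv p (w' - w).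
  apply: le_trans (dotv_ge _ _); rewrite lerN2 ler_wpM2r//.
  exact: enorm_lincomb_le z_ge0 (ph_sub hs0) (fun i => th_sub (hs i)).
have hd := ascent_three_point g0 (@segment_closed_nonneg R m) z0_ge0 dual.
(* Young's inequality; the square |z' - z|^2 that it costs is the one supplied by the dual
   three-point inequality. *)
have hd2 : 2 * gam * dotv (\col_i th' i w') (z' - z)
    <= enorm (z' - z) ^+ 2 + gam ^+ 2 * Dt2.
  have := dotvv_ge0 ((z' - z) - gam *: \col_i th' i w').
  rewrite !(dotvBl (z' - z), dotvBr _ (z' - z), dotvZl, dotvZr) -!enorm_sqr.
  rewrite (dotvC (z' - z)).
  have := dual_step_map_sqr; rewrite -(ler_pM2l (exprn_gt0 2 g0)); lra.
have hd3 : \sum_i (z0 i 0 - z i 0) * th' i w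
    <= dotv (\col_i th' i w') (z0 - z) + (\sum_i `|z0 i 0 - z i 0| * Ct i) * dl.
  rewrite mulr_suml -big_split/=; apply: ler_sum => i _; rewrite !mxE.
  have := th'_lip i Ww' Ww; rewrite -/dl => hl.
  have : (z0 i 0 - z i 0) * (th' i w - th' i w') <= `|z0 i 0 - z i 0| * (Ct i * dl).
    apply: le_trans (ler_norm _) _; rewrite normrM ler_wpM2l//.
    by rewrite distrC.
  lra.
have hL : Ph w' - Ph w + \sum_i z0 i 0 * (Th i w' - Th i w)
    <= (Cp + \sum_i z0 i 0 * Ct i) * dl.
  rewrite mulrDl; apply: lerD.
    by apply: le_trans (ler_norm _) _; exact: Ph_lip.
  rewrite mulr_suml; apply: ler_sum => i _; rewrite -mulrA ler_wpM2l ?z0_ge0//.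
  by apply: le_trans (ler_norm _) _; exact: Th_lip.
have hsum : \sum_i z i 0 * Ct i + \sum_i `|z0 i 0 - z i 0| * Ct i
    + \sum_i z0 i 0 * Ct i = 2 * S.
  rewrite -!big_split/= mulr_sumr; apply: eq_bigr => i _.
  rewrite mulrA -!mulrDl; congr (_ * _).
  case: (leP (z i 0) (z0 i 0)) => hz.
    by rewrite ger0_norm ?subr_ge0//; ring.
  by rewrite ler0_norm ?subr_le0 ?ltW//; ring.
have e1 : dotv p (w' - ws) = dotv p (w' - w) + dotv p (w - ws).
  by rewrite -dotvDr addrA subrK.
have e2 : dotv (\col_i th' i w') (z0 - z')
    = dotv (\col_i th' i w') (z0 - z) - dotv (\col_i th' i w') (z' - z).
  by rewrite -dotvBr opprB addrA subrK.
(* The square [dl ^+ 2] left by the primal three-point inequality absorbs every displacement error.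
   The constant is 8 = 4 * 2, with (Cp + S)^2 <= 2 Cp^2 + 2 S^2; doubled once more at the end, it
   becomes the 16 of P2 and P3. *)
have hq : 2 * gam * ((2 * (Cp + S)) * dl) - dl ^+ 2
    <= 8 * gam ^+ 2 * Cp ^+ 2 + 8 * gam ^+ 2 * Ct2 * \sum_i Num.max (z0 i 0) (z i 0) ^+ 2.
  have := sqr_ge0 (2 * gam * (Cp + S) - dl).
  have := sqr_ge0 (gam * (Cp - S)).
  have := ler_wpM2l (sqr_ge0 gam) hS.
  lra.
move: h3 hd; rewrite e1 e2 -/dl.
set X1 := dotv p (w' - w) in hp2 *; set X2 := dotv p (w - ws) in hp1 *.
set X3 := dotv _ (z0 - z) in hd3 *; set X4 := dotv _ (z' - z) in hd2 *.
set A1 := ph w - _ + _ in hp1 *; set A2 := \sum_i _ * th' i w in hd3 *.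
set A3 := Ph w' - _ + _ in hL *.
set B1 := \sum_i z i 0 * Ct i in hp2 hsum *.
set B2 := \sum_i `|_| * Ct i in hd3 hsum *.
set B3 := \sum_i z0 i 0 * Ct i in hL hsum *.
move=> h3 hd.
have hA : A1 + A2 + A3 <= X1 + X2 + X3 + (2 * (Cp + S)) * dl.
  have -> : 2 * (Cp + S) = Cp + B1 + B2 + (Cp + B3) by lra.
  lra.
have : 2 * gam * (A1 + A2 + A3) <= 2 * gam * (X1 + X2 + X3 + (2 * (Cp + S)) * dl).
  by apply: ler_wpM2l hA; apply: mulr_ge0 (ltW g0).
lra.
Qed.

End step_gap.
End one_step.
End step.

(** * The integrands of the reformulated problem *)

Section product_space.
Context {R : realType} {n m : nat}.
Implicit Types (v w : 'cV[R]_(n + 1 + m)) (x y : 'cV[R]_n) (u : 'cV[R]_m).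

Lemma wx_mkw x a u : wx (mkw x a u) = x.
Proof. by rewrite /wx /mkw col_mxKu col_mxKu. Qed.

Lemma wu0_mkw x a u : wu0 (mkw x a u) = a.
Proof. by rewrite /wu0 /mkw col_mxKu col_mxKd mxE eqxx mulr1n. Qed.

Lemma wu_mkw x a u : wu (mkw x a u) = u.
Proof. by rewrite /wu /mkw col_mxKd. Qed.

Lemma wxD v w : wx (v + w) = wx v + wx w.
Proof. by rewrite /wx !linearD. Qed.

Lemma wxZ a v : wx (a *: v) = a *: wx v.
Proof. by rewrite /wx !linearZ. Qed.

Lemma wxB v w : wx (v - w) = wx v - wx w.
Proof. by rewrite -scaleN1r wxD wxZ scaleN1r. Qed.

Lemma wuD v w : wu (v + w) = wu v + wu w.
Proof. by rewrite /wu !linearD. Qed.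

Lemma wuZ a v : wu (a *: v) = a *: wu v.
Proof. by rewrite /wu !linearZ. Qed.

Lemma wuB v w : wu (v - w) = wu v - wu w.
Proof. by rewrite -scaleN1r wuD wuZ scaleN1r. Qed.

Lemma dotv_prod v w :
  dotv v w = dotv (wx v) (wx w) + wu0 v * wu0 w + dotv (wu v) (wu w).
Proof.
rewrite /dotv big_split_ord/= big_split_ord/= big_ord1; congr (_ + _ + _).
- by apply: eq_bigr => i _; rewrite !mxE.
- by rewrite /wu0 !mxE.
- by apply: eq_bigr => i _; rewrite !mxE.
Qed.

(** Unit vectors of the auxiliary coordinates. With [e] one of them, phi and each theta^i take the
    common form [psi h (wx v) (dotv e v) delta], so one subgradient bound and one Lipschitz bound
    serve both. *)
Definition e0 : 'cV[R]_(n + 1 + m) := mkw 0 1 0.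
Definition ei (i : 'I_m) : 'cV[R]_(n + 1 + m) := mkw 0 0 (delta_mx i 0).

Lemma dotv_delta i u : dotv (delta_mx i 0) u = u i 0.
Proof.
rewrite /dotv (bigD1 i)//= mxE !eqxx mul1r big1 ?addr0// => j ji.
by rewrite mxE (negbTE ji) mul0r.
Qed.

Lemma dotv_e0 v : dotv e0 v = wu0 v.
Proof. by rewrite dotv_prod wx_mkw wu0_mkw wu_mkw !dotv0l mul1r add0r addr0. Qed.

Lemma dotv_ei i v : dotv (ei i) v = wu v i 0.
Proof. by rewrite dotv_prod wx_mkw wu0_mkw wu_mkw dotv_delta dotv0l mul0r !add0r. Qed.

Lemma wx_e0 : wx e0 = 0. Proof. exact: wx_mkw. Qed.
Lemma wx_ei i : wx (ei i) = 0. Proof. exact: wx_mkw. Qed.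
Lemma dotv_e0e0 : dotv e0 e0 = 1. Proof. by rewrite dotv_e0 wu0_mkw. Qed.
Lemma dotv_eiei i : dotv (ei i) (ei i) = 1.
Proof. by rewrite dotv_ei wu_mkw mxE !eqxx. Qed.

End product_space.

Section psi.
Context {R : realType} {n m : nat}.
Variables (h : 'cV[R]_n -> R) (delta C : R).
Hypothesis delta01 : 0 <= delta < 1.
Let kap := (1 - delta)^-1.

Lemma kap_ge1 : 1 <= kap.
Proof. by case/andP: delta01 => d0 d1; rewrite /kap invf_ge1; lra. Qed.

Lemma kapM : kap * (1 - delta) = 1.
Proof. by case/andP: delta01 => d0 d1; rewrite /kap mulVf// gt_eqF//; lra. Qed.

Lemma psi_ge_h x u : h x <= psi h x u delta.
Proof.
rewrite /psi -/kap; have := kap_ge1.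
have : h x - u <= Num.max (h x - u) 0 by rewrite le_max lexx.
have : 0 <= Num.max (h x - u) 0 by rewrite le_max lexx orbT.
nra.
Qed.

(** psi is piecewise affine, with slope 0 or [kap] in the value of [h] and slope 1 or 1 - [kap] in
    [u]. *)
Lemma psi_sub_le x y u v a b :
  `|h x - h y| <= a -> `|u - v| <= b -> psi h x u delta - psi h y v delta <= kap * (a + b).
Proof.
rewrite !ler_norml /psi -/kap => /andP[a1 a2] /andP[b1 b2].
have k1 := kap_ge1.
have : 0 <= kap * Num.max (h y - v) 0 by rewrite mulr_ge0 ?le_max ?lexx ?orbT//; lra.
have : kap * (h y - v) <= kap * Num.max (h y - v) 0.
  by rewrite ler_pM2l ?le_max ?lexx//; lra.
have [_|_] := leP (h x - u) 0 => h1 h2; nra.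
Qed.

Lemma psi_shift x u t : 0 <= t ->
  psi h x (u + t) delta - psi h x u delta <= t /\
  psi h x (u - t) delta - psi h x u delta <= (kap - 1) * t.
Proof.
move=> t0; rewrite /psi -/kap; have k1 := kap_ge1; split.
  have : kap * Num.max (h x - (u + t)) 0 <= kap * Num.max (h x - u) 0; last by lra.
  rewrite ler_pM2l; last by lra.
  by rewrite ge_max !le_max lexx orbT andbT; apply/orP; left; lra.
have : kap * Num.max (h x - (u - t)) 0 <= kap * (Num.max (h x - u) 0 + t); last by lra.
rewrite ler_pM2l; last by lra.
rewrite ge_max; apply/andP; split.
  have : h x - u <= Num.max (h x - u) 0 by rewrite le_max lexx.
  lra.
have : 0 <= Num.max (h x - u) 0 by rewrite le_max lexx orbT.
lra.
Qed.

(** The extreme case is h x = B, u = - B, with value - B + 2 B / (1 - delta). This is the origin of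
    the factor (1 + beta) / (1 - beta) in P2. *)
Lemma psi_bound x u B : `|h x| <= B -> `|u| <= B ->
  `|psi h x u delta| <= (1 + delta) / (1 - delta) * B.
Proof.
rewrite !ler_norml => /andP[a1 a2] /andP[b1 b2]; rewrite /psi -/kap.
have k1 := kap_ge1; have kM := kapM; case/andP: delta01 => d0 d1.
have B0 : 0 <= B by lra.
have kd : 0 <= kap * delta by rewrite mulr_ge0//; lra.
have kdB : 0 <= (kap * delta) * B by rewrite mulr_ge0.
have kdu : (kap * delta) * (- u) <= (kap * delta) * B by rewrite ler_wpM2l//; lra.
have kdu' : (kap * delta) * u <= (kap * delta) * B by rewrite ler_wpM2l//; lra.
have kh : kap * h x <= kap * B by rewrite ler_wpM2l//; lra.
have e1 : kap * u = u + kap * delta * u.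
  by have := congr1 ( *%R^~ u) kM; rewrite /= mul1r; lra.
have e2 : (1 + delta) * kap * B = B + 2 * (kap * delta * B).
  by have := congr1 ( *%R^~ B) kM; rewrite /= mul1r; lra.
rewrite e2; have [hu|hu] := leP (h x - u) 0; first by apply/andP; split; lra.
have : 0 <= kap * (h x - u) by rewrite mulr_ge0//; lra.
rewrite mulrBr => ?; apply/andP; split; lra.
Qed.

Variable e : 'cV[R]_(n + 1 + m).
Hypotheses (wxe : wx e = 0) (ee : dotv e e = 1).
Let ix (y : 'cV[R]_n) : 'cV[R]_(n + 1 + m) := mkw y 0 0.

Let dotv_ix v y : dotv v (ix y) = dotv (wx v) y.
Proof. by rewrite dotv_prod wx_mkw wu0_mkw wu_mkw dotv0r mulr0 !addr0. Qed.

Let J v := psi h (wx v) (dotv e v) delta.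

(** Pythagoras for the x-part, the component along [e] and the remainder, which are orthogonal
    because [wx e = 0]. *)
Let enorm_split (v : 'cV[R]_(n + 1 + m)) :
  dotv v v = dotv (wx v) (wx v) + dotv e v ^+ 2
    + dotv (v - ix (wx v) - dotv e v *: e) (v - ix (wx v) - dotv e v *: e).
Proof.
set c := dotv e v.
have e1 : dotv v (ix (wx v)) = dotv (wx v) (wx v) by rewrite dotv_ix.
have e2 : dotv e (ix (wx v)) = 0 by rewrite dotv_ix wxe dotv0l.
have e3 : dotv (ix (wx v)) (ix (wx v)) = dotv (wx v) (wx v).
  by rewrite dotv_ix wx_mkw.
rewrite !(dotvBl, dotvBr, dotvZl, dotvZr) (dotvC (ix _) v) (dotvC (ix _) e) (dotvC v e).
rewrite e1 e2 e3 ee -/c; ring.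
Qed.

(* For a subgradient [s], moving along [e] bounds its last component [sg], and moving
   x to y while keeping h - u constant gives <s_x, y - x> <= (1 - sg) (h y - h x); mixing in
   [t] times a subgradient of [h] covers the case sg = 1. *)
Lemma psi_subdiff_bound (D : set 'cV[R]_n) w s :
  D (wx w) -> subdiff D h (wx w) !=set0 ->
  (forall r, subdiff D h (wx w) r -> enorm r <= C) ->
  subdiff [set v | D (wx v)] J w s ->
  enorm s <= Num.sqrt (C ^+ 2 + 1) * kap.
Proof.
move=> Dw [r hr] hC hs.
have k1 := kap_ge1.
set sg := dotv e s.
have C0 : 0 <= C by exact: le_trans (enorm_ge0 _) (hC _ hr).
have move_e t : J w + t * sg <= psi h (wx w) (dotv e w + t) delta.
  have := hs (w + t *: e); rewrite /= wxD wxZ wxe scaler0 addr0 => /(_ Dw).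
  rewrite [w + _ - w]addrC addKr dotvZr (dotvC s) /J wxD wxZ wxe scaler0 addr0.
  by rewrite dotvDr dotvZr ee mulr1.
have sg1 : sg <= 1.
  have := move_e 1; have [+ _] := @psi_shift (wx w) (dotv e w) 1 ler01.
  by rewrite /J; lra.
have sg2 : 1 - kap <= sg.
  have := move_e (-1); have [_] := @psi_shift (wx w) (dotv e w) 1 ler01.
  by rewrite /J; lra.
pose rho := 1 - sg.
have rho0 : 0 <= rho by rewrite /rho; lra.
have rhok : rho <= kap by rewrite /rho; lra.
have sx y : D y -> dotv (wx s) (y - wx w) <= rho * (h y - h (wx w)).
  move=> Dy; have := hs (w + (ix (y - wx w) + (h y - h (wx w)) *: e)).
  rewrite /= /J !wxD wxZ wxe wx_mkw scaler0 addr0 [wx w + _]addrC subrK => /(_ Dy).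
  rewrite [w + _ - w]addrC addKr !(dotvDr s, dotvDr e) !dotvZr !dotv_ix wxe dotv0l ee add0r mulr1.
  rewrite (dotvC s e) -/sg /psi.
  rewrite [h y - (_ + _)](_ : _ = h (wx w) - dotv e w); last by ring.
  rewrite /rho; lra.
have hmix t : 0 < t -> enorm (wx s + t *: r) <= (rho + t) * C.
  move=> t0; have rt : 0 < rho + t by lra.
  have := hC ((rho + t)^-1 *: (wx s + t *: r)).
  rewrite enormZ gtr0_norm ?invr_gt0// mulrC ler_pdivrMr// mulrC; apply.
  move=> y Dy; rewrite dotvZl dotvDl dotvZl.
  have := sx _ Dy; have := hr _ Dy => h1 h2.
  rewrite addrC -lerBrDr mulrC ler_pdivrMr//.
  have : t * dotv r (y - wx w) <= t * (h y - h (wx w)) by rewrite ler_pM2l//; lra.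
  lra.
have sxC : enorm (wx s) <= rho * C.
  rewrite -subr_ge0; apply: (@ge0_of_small_slope _ _ (2 * C)) => t /andP[t0 _].
  have := hmix _ t0; have := enormB (wx s + t *: r) (t *: r).
  rewrite addrK enormZ gtr0_norm// => h1 h2.
  have : t * enorm r <= t * C by rewrite ler_pM2l// hC.
  lra.
(* The function ignores directions that both [wx] and [e] annihilate. Applied to the remainder of
   [s] itself, this shows that the remainder vanishes. *)
have perp d : wx d = 0 -> dotv e d = 0 -> dotv s d <= 0.
  move=> d1 d2; have := hs (w + d); rewrite /= /J wxD d1 addr0 => /(_ Dw).
  rewrite [w + _ - w]addrC addKr dotvDr d2 addr0; lra.
set d := s - ix (wx s) - sg *: e.
have wxd : wx d = 0 by rewrite /d !wxB wxZ wxe wx_mkw scaler0 subr0 subrr.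
have ed : dotv e d = 0.
  by rewrite /d !dotvBr dotvZr dotv_ix wxe dotv0l ee mulr1 subr0 subrr.
have dd : dotv d d <= 0.
  have -> : dotv d d = dotv d s - dotv d (ix (wx s)) - sg * dotv d e.
    by rewrite -dotvZr -!dotvBr.
  by rewrite dotv_ix wxd dotv0l (dotvC d e) ed mulr0 !subr0 dotvC perp.
have ss : enorm s ^+ 2 <= (C ^+ 2 + 1) * kap ^+ 2.
  rewrite enorm_sqr (enorm_split s) -/sg -/d -enorm_sqr.
  have q1 : enorm (wx s) ^+ 2 <= (kap * C) ^+ 2.
    rewrite ler_pXn2r ?nnegrE ?enorm_ge0 ?mulr_ge0//; last by lra.
    by apply: le_trans sxC _; rewrite ler_wpM2r.
  have q2 : sg ^+ 2 <= kap ^+ 2.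
    by rewrite -[leLHS]real_normK ?num_real// ler_pXn2r ?nnegrE//;
       [rewrite ler_norml; lra|lra].
  nra.
rewrite -(@ler_pXn2r _ 2)// ?nnegrE ?enorm_ge0 ?mulr_ge0 ?sqrtr_ge0//; last by lra.
by rewrite exprMn [Num.sqrt (_ + _) ^+ 2]sqr_sqrtr// addr_ge0// sqr_ge0.
Qed.

(** Cauchy-Schwarz, C a + b <= sqrt (C^2 + 1) sqrt (a^2 + b^2), yields the same constant as the
    subgradient bound. *)
Lemma psi_lipschitz v w :
  `|h (wx v) - h (wx w)| <= C * enorm (wx v - wx w) ->
  `|J v - J w| <= Num.sqrt (C ^+ 2 + 1) * kap * enorm (v - w).
Proof.
move=> hl; have k1 := kap_ge1.
have hu : `|dotv e v - dotv e w| <= `|dotv e (v - w)| by rewrite dotvBr.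
have -> : Num.sqrt (C ^+ 2 + 1) * kap * enorm (v - w)
    = kap * (Num.sqrt (C ^+ 2 + 1) * enorm (v - w)) by ring.
apply: le_trans (_ : kap * (C * enorm (wx v - wx w) + `|dotv e (v - w)|) <= _).
  rewrite ler_norml lerNl opprB.
  by apply/andP; split; apply: psi_sub_le => //; rewrite distrC.
rewrite ler_pM2l; last by lra.
set a := enorm (wx v - wx w).
rewrite [enorm (v - w)]/enorm -sqrtrM; last by rewrite addr_ge0// sqr_ge0.
apply: le_trans (ler_norm _) _; rewrite -sqrtr_sqr ler_wsqrtr//.
rewrite (enorm_split (v - w)) wxB -(enorm_sqr (wx v - wx w)) -/a.
set d := (_ - _ *: e); have := dotvv_ge0 d.
set q := dotv d d; rewrite -(@real_normK _ (dotv e _)) ?num_real//.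
set b := `|_| => q0.
have := sqr_ge0 (a - C * b); have : 0 <= (C ^+ 2 + 1) * q by rewrite mulr_ge0// addr_ge0 ?sqr_ge0.
lra.
Qed.

End psi.

(** * Averages of iterates and Jensen's inequality *)

Section averages.
Context {R : realType}.

(** The new average lies on the segment from the old one to the new point, so closedness under
    segments suffices for averages by induction. *)
Lemma sum_nat_avgS (V : lmodType R) (K : nat) (x : nat -> V) :
  (K.+2)%:R^-1 *: \sum_(1 <= k < K.+3) x k =
  (K.+1)%:R^-1 *: \sum_(1 <= k < K.+2) x k
  + (K.+2)%:R^-1 *: (x K.+2 - (K.+1)%:R^-1 *: \sum_(1 <= k < K.+2) x k).
Proof.
rewrite big_nat_recr//= scalerDr scalerBr addrA [RHS]addrAC; congr (_ + _).
rewrite scalerA -scalerBl; congr (_ *: _).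
rewrite -natr1; have : (0 : R) < K.+1%:R by rewrite ltr0n.
move: (K.+1%:R : R) => a a0; field; apply/andP; split; lra.
Qed.

Lemma segment_closed_avg (N K : nat) (A : set 'cV[R]_N) (x : nat -> 'cV[R]_N) :
  segment_closed A -> (0 < K)%N ->
  (forall k, (1 <= k <= K)%N -> A (x k)) ->
  A (K%:R^-1 *: \sum_(1 <= k < K.+1) x k).
Proof.
move=> cA; case: K => // K _; elim: K => [|K IH] hx.
  by rewrite big_nat1 invr1 scale1r; exact: hx.
rewrite sum_nat_avgS; apply: cA; [|by apply: hx; rewrite leqnn|].
  by apply: IH => k /andP[k1 k2]; apply: hx; rewrite k1 ltnW.
by rewrite invr_ge0 ler0n/= invf_le1 ?ltr0n// ler1n.
Qed.

(** Sum the subgradient inequality at the average over the points: the linear terms cancel. *)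
Lemma subdiff_jensen (N K : nat) (D : set 'cV[R]_N) (h : 'cV[R]_N -> R)
    (x : 'I_K -> 'cV[R]_N) :
  (0 < K)%N -> (forall k, D (x k)) ->
  subdiff D h (K%:R^-1 *: \sum_k x k) !=set0 ->
  h (K%:R^-1 *: \sum_k x k) <= K%:R^-1 * \sum_k h (x k).
Proof.
move=> K0 hx [s]; set xb := _ *: _ => hs.
have K0' : (0 : R) < K%:R by rewrite ltr0n.
rewrite mulrC ler_pdivlMr//.
have : \sum_k (h xb + dotv s (x k - xb)) <= \sum_k h (x k).
  by apply: ler_sum => k _; exact: hs.
rewrite big_split/= sumr_const card_ord mulr_natr.
suff -> : \sum_k dotv s (x k - xb) = 0 by rewrite addr0.
under eq_bigr do rewrite dotvC.
rewrite -dotv_suml big_split/= sumrN sumr_const card_ord.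
rewrite -[X in X - _]scale1r -(@mulfV _ (K%:R : R)) ?gt_eqF// -scalerA -/xb.
by rewrite scaler_nat subrr dotv0l.
Qed.

Lemma psi_jensen (n K : nat) (D : set 'cV[R]_n) (h : 'cV[R]_n -> R)
    (delta : R) (x : 'I_K -> 'cV[R]_n) (u : 'I_K -> R) :
  0 <= delta < 1 -> (0 < K)%N -> (forall k, D (x k)) ->
  subdiff D h (K%:R^-1 *: \sum_k x k) !=set0 ->
  psi h (K%:R^-1 *: \sum_k x k) (K%:R^-1 * \sum_k u k) delta
    <= K%:R^-1 * \sum_k psi h (x k) (u k) delta.
Proof.
move=> d01 K0 hx hs; have K0' : (0 : R) < K%:R^-1 by rewrite invr_gt0 ltr0n.
have := subdiff_jensen K0 hx hs; have := kap_ge1 d01.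
rewrite /psi big_split/= -mulr_sumr mulrDr; set kp := (1 - delta)^-1 => k1 hj.
rewrite lerD2l mulrCA ler_pM2l; last by lra.
rewrite ge_max; apply/andP; split; last first.
  by rewrite mulr_ge0 ?(ltW K0')//; apply: sumr_ge0 => k _; rewrite le_max lexx orbT.
rewrite lerBlDr; apply: le_trans hj _; rewrite -mulrDr ler_pM2l// -big_split/=.
by apply: ler_sum => k _; rewrite -lerBlDr le_max lexx.
Qed.

Lemma segment_closed_convex_set (N : nat) (A : set 'cV[R]_N) :
  convex_set A -> segment_closed A.
Proof.
move=> cA x y s Ax Ay /andP[s0 s1].
have /(_ y x (Itv01 s0 s1)) := cA; rewrite !inE => /(_ Ay Ax).
congr (A _); rewrite [LHS]/conv/=.
by rewrite scalerBr scalerBl scale1r addrC -addrA [- _ + _]addrC.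
Qed.

Lemma segment_closed_Wset (n m : nat) (X : set 'cV[R]_n) (DG : 'cV[R]_m) :
  segment_closed X -> segment_closed (Wset X DG).
Proof.
move=> cX v w s [v1 v2] [w1 w2] s01; split.
  by rewrite wxD wxZ wxB; exact: cX.
move=> i; rewrite wuD wuZ wuB.
have -> : (wu v + s *: (wu w - wu v)) i 0 = wu v i 0 + s * (wu w i 0 - wu v i 0).
  by rewrite !mxE.
have := v2 i; have := w2 i; rewrite !ler_norml; case/andP: s01 => s0 s1.
move=> /andP[a1 a2] /andP[b1 b2].
have s1' : 0 <= 1 - s by rewrite subr_ge0.
apply/andP; split.
  have := ler_wpM2l s0 a1; have := ler_wpM2l s1' b1; lra.
have := ler_wpM2l s0 a2; have := ler_wpM2l s1' b2; lra.
Qed.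

End averages.

(** * Essentially bounded random variables and independence *)

Section integral_full.
Context {d} {T : measurableType d} {R : realType}.
Variables (Q : probability T R) (T' : set T).
Hypotheses (mT' : measurable T') (QT' : Q T' = 1%E).

Lemma le_Rintegral_full (f g : T -> R) :
  Q.-integrable setT (EFin \o f) -> Q.-integrable setT (EFin \o g) ->
  (forall t, T' t -> f t <= g t) -> \int[Q]_t f t <= \int[Q]_t g t.
Proof.
move=> intf ig fg.
have QN : Q (~` T') = 0%E by rewrite probability_setC// QT' subee.
rewrite /Rintegral !(@negligible_integral _ _ _ Q setT (~` T'))//; try exact: measurableC.
rewrite setTD setCK.
by apply: le_Rintegral => //; apply: integrableS intf || apply: integrableS ig.
Qed.

Lemma eq_Rintegral_full (f g : T -> R) :
  Q.-integrable setT (EFin \o f) -> Q.-integrable setT (EFin \o g) ->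
  (forall t, T' t -> f t = g t) -> \int[Q]_t f t = \int[Q]_t g t.
Proof.
by move=> intf ig fg; apply/eqP; rewrite eq_le !le_Rintegral_full// => t /fg ->.
Qed.

End integral_full.

Section essentially_bounded.
Context {d} {T : measurableType d} {R : realType}.
Variables (Q : probability T R) (T' : set T).
Hypotheses (mT' : measurable T') (QT' : Q T' = 1%E).
Implicit Types f g : T -> R.

(** Boundedness on a fixed full-measure set is stable under sums and products and implies
    integrability, so products of iterates need no moment estimates. *)
Definition essb f :=
  measurable_fun setT f /\ exists B, forall t, T' t -> `|f t| <= B.

Lemma essb_cst c : essb (cst c).
Proof. by split; [exact: measurable_cst|exists `|c|]. Qed.

Lemma essbD f g : essb f -> essb g -> essb (fun t => f t + g t).
Proof.
move=> [mf [B hB]] [mg [B' hB']]; split; first exact: measurable_funD.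
exists (B + B') => t Tt; apply: le_trans (ler_normD _ _) _.
by rewrite lerD ?hB ?hB'.
Qed.

Lemma essbM f g : essb f -> essb g -> essb (fun t => f t * g t).
Proof.
move=> [mf [B hB]] [mg [B' hB']]; split; first exact: measurable_funM.
by exists (B * B') => t Tt; rewrite normrM ler_pM ?hB ?hB'.
Qed.

Lemma essbZ c f : essb f -> essb (fun t => c * f t).
Proof. exact/essbM/essb_cst. Qed.

Lemma essbB f g : essb f -> essb g -> essb (fun t => f t - g t).
Proof.
move=> hf hg; have := essbD hf (essbZ (-1) hg).
by congr essb; apply/funext => t; rewrite mulN1r.
Qed.

Lemma essb_sum (I : Type) (r : seq I) (F : I -> T -> R) :
  (forall i, essb (F i)) -> essb (fun t => \sum_(i <- r) F i t).
Proof.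
move=> hF; elim: r => [|i r IH].
  by under eq_fun do rewrite big_nil; exact: essb_cst.
by under eq_fun do rewrite big_cons; exact: essbD.
Qed.

Lemma essb_integrable f : essb f -> Q.-integrable setT (EFin \o f).
Proof.
move=> [mf [B hB]].
have QN : Q (~` T') = 0%E by rewrite probability_setC// QT' subee.
have mEf : measurable_fun setT (EFin \o f) by exact/measurable_EFinP.
apply/(negligible_integrable (measurableC mT') measurableT mEf QN).
rewrite setTD setCK.
apply: measurable_bounded_integrable => //; first by rewrite [X in (X < _)%E]QT' ltry.
- exact: measurable_funTS.
- exists B; split; first exact: num_real.
  by move=> x Bx t Tt; apply: le_trans (hB _ Tt) (ltW Bx).
Qed.

Lemma essb_le_Rintegral f g : essb f -> essb g -> (forall t, T' t -> f t <= g t) ->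
  \int[Q]_t f t <= \int[Q]_t g t.
Proof. by move=> hf hg; apply: (le_Rintegral_full mT' QT') => //; exact: essb_integrable. Qed.

Lemma essb_RintegralD f g : essb f -> essb g ->
  \int[Q]_t (f t + g t) = \int[Q]_t f t + \int[Q]_t g t.
Proof. by move=> hf hg; rewrite RintegralD//; exact: essb_integrable. Qed.

Lemma essb_RintegralB f g : essb f -> essb g ->
  \int[Q]_t (f t - g t) = \int[Q]_t f t - \int[Q]_t g t.
Proof. by move=> hf hg; rewrite RintegralB//; exact: essb_integrable. Qed.

Lemma essb_RintegralZl c f : essb f -> \int[Q]_t (c * f t) = c * \int[Q]_t f t.
Proof. by move=> hf; rewrite RintegralZl//; exact: essb_integrable. Qed.

Lemma probability_Rintegral_cst c : \int[Q]_t (cst c t) = c.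
Proof. by rewrite Rintegral_cst// [X in fine X]probability_setT mulr1. Qed.

Lemma essb_Rintegral_sum (I : Type) (r : seq I) (F : I -> T -> R) :
  (forall i, essb (F i)) ->
  \int[Q]_t (\sum_(i <- r) F i t) = \sum_(i <- r) \int[Q]_t F i t.
Proof.
move=> hF; elim: r => [|i r IH].
  rewrite big_nil; under eq_Rintegral do rewrite big_nil.
  exact: probability_Rintegral_cst.
rewrite big_cons -IH -essb_RintegralD//; last exact: essb_sum.
by apply: eq_Rintegral => t _; rewrite big_cons.
Qed.

End essentially_bounded.

(** * Measurability of Lipschitz functions of random points *)

Section lipschitz_measurable.
Context {R : realType} {N : nat}.

Lemma exists_dense_seq (W : set 'cV[R]_N) (p0 : 'cV[R]_N) : W p0 ->
  exists2 q : nat -> 'cV[R]_N, (forall l, W (q l)) &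
    forall p eps, W p -> 0 < eps -> exists l, \sum_(i < N) `|p i 0 - q l i 0| < eps.
Proof.
move=> Wp0.
(* [W] need not contain rational points, so each rational centre and each radius select a point of
   [W] nearby, with default [p0] when there is none. *)
pose cond (c : 'cV[rat]_N * nat) : set 'cV[R]_N :=
  [set p | W p /\ forall i, `|p i 0 - ratr (c.1 i 0)| < c.2.+1%:R^-1].
pose q l := if unpickle l is Some c then xget p0 (cond c) else p0.
exists q => [l|p eps Wp e0].
  by rewrite /q; case: unpickle => // c; case: xgetP => // x _ [].
have N0 : (0 : R) < N.+1%:R by rewrite ltr0n.
(* The factor 2 pays for passing through the rational centre in each coordinate; [N.+1] instead of
   [N] covers N = 0. *)
have d0 : 0 < eps / (2 * N.+1%:R) by rewrite divr_gt0// mulr_gt0.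
pose k := Num.truncn (eps / (2 * N.+1%:R))^-1.
have hk : k.+1%:R^-1 < eps / (2 * N.+1%:R).
  by rewrite invf_plt ?posrE// Num.Theory.truncnS_gt.
have k0 : (0 : R) < k.+1%:R^-1 by rewrite invr_gt0 ltr0n.
have [e eE] : exists e : R, e = k.+1%:R^-1 by exists k.+1%:R^-1.
rewrite -eE in hk k0.
have hr i : exists r : rat, `|p i 0 - ratr r| < e.
  have hlt : p i 0 - e < p i 0 + e by lra.
  have [r] := rat_in_itvoo hlt.
  rewrite in_itv/= => /andP[r1 r2]; exists r; rewrite ltr_norml; apply/andP; split; lra.
pose r : 'cV[rat]_N := \col_i xchoose (hr i).
have condp : cond (r, k) p.
  by split => // i /=; rewrite mxE -eE; exact: xchooseP (hr i).
exists (pickle (r, k)); rewrite /q pickleK.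
have [Wx hx] : cond (r, k) (xget p0 (cond (r, k))) by exact: xgetI condp.
set x := xget _ _ in hx *.
apply: le_lt_trans (_ : \sum_(i < N) 2 * e < _).
  apply: ler_sum => i _; have := condp.2 i; have := hx i => /=; rewrite -eE => a b.
  have := ler_distD (ratr (r i 0)) (p i 0) (x i 0).
  rewrite (distrC (ratr _) (x i 0)); lra.
rewrite sumr_const card_ord -[_ *+ N]mulr_natl.
have N1 : N.+1%:R = N%:R + 1 :> R by rewrite natr1.
have : (0 : R) <= N%:R by rewrite ler0n.
have hX (a : R) : 0 < a -> eps = a * (2 * (eps / (2 * a))).
  by move=> a0; field; rewrite gt_eqF.
move: hk d0 (hX _ N0); rewrite N1.
move: (N%:R : R) (eps / (2 * (N%:R + 1))) => M X hk d0 -> M0.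
apply: le_lt_trans (_ : M * (2 * X) < _); first by rewrite ler_wpM2l//; lra.
rewrite mulrDl; lra.
Qed.

(* Writing [h t (v t)] as the infimum of [h t q + C |v t - q|] over a countable dense
   set of points [q] avoids any measurable structure on vectors. *)
Lemma measurable_lipschitz_comp {d} {T : measurableType d} (W : set 'cV[R]_N)
    (h : T -> 'cV[R]_N -> R) (C : R) (v : T -> 'cV[R]_N) :
  (forall t p q, W p -> W q -> `|h t p - h t q| <= C * enorm (p - q)) ->
  (forall p, W p -> measurable_fun setT (h ^~ p)) ->
  (forall i, measurable_fun setT (fun t => v t i 0)) ->
  (forall t, W (v t)) ->
  measurable_fun setT (fun t => h t (v t)).
Proof.
move=> hl hm mv Wv.
have [q Wq hq] := exists_dense_seq (Wv point).
have C1 : 0 < `|C| + 1 by have := normr_ge0 C; lra.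
have hl' t p r : W p -> W r -> h t p - h t r <= (`|C| + 1) * \sum_(i < N) `|p i 0 - r i 0|.
  move=> Wp Wr; apply: le_trans (ler_norm _) _; apply: le_trans (hl _ _ _ Wp Wr) _.
  apply: le_trans (_ : (`|C| + 1) * enorm (p - r) <= _).
    by rewrite ler_wpM2r ?enorm_ge0//; have := ler_norm C; lra.
  rewrite ler_pM2l//; apply: le_trans (enorm_le_l1 _) _.
  by apply: ler_sum => i _; rewrite !mxE.
pose k l t := h t (q l) + (`|C| + 1) * \sum_(i < N) `|v t i 0 - q l i 0|.
have mk l : measurable_fun setT (k l).
  apply: measurable_funD; first exact: hm.
  apply: measurable_funM; first exact: measurable_cst.
  apply: measurable_sum => i; apply: measurableT_comp => //.
  by apply: measurable_funB => //; exact: measurable_cst.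
move=> mD; apply: (measurability _ (RGenInftyO.measurableE R)) => //.
move=> _ [_ [c ->] <-]; rewrite setTI.
rewrite [X in measurable X](_ : _ = \bigcup_l (k l @^-1` `]-oo, c[)); last first.
  apply/seteqP; split => t /=.
    rewrite in_itv/= => htc.
    have e0 : 0 < (c - h t (v t)) / (2 * (`|C| + 1)).
      by rewrite divr_gt0 ?subr_gt0 ?mulr_gt0.
    have [l hlt] := hq _ _ (Wv t) e0.
    exists l => //=; rewrite in_itv/= /k.
    have := hl' t (q l) (v t) (Wq l) (Wv t).
    under eq_bigr do rewrite distrC.
    move: hlt; rewrite ltr_pdivlMr ?mulr_gt0//; set s := \sum_(_ < _) _; lra.
  move=> [l _] /=; rewrite !in_itv/= /k => h1.
  have := hl' t (v t) (q l) (Wv t) (Wq l); lra.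
by apply: bigcupT_measurable => l; rewrite -[X in measurable X]setTI; exact: mk.
Qed.

End lipschitz_measurable.

(** * Averaging out an independent sample *)

Section independence.
Context {dT dO} {T : measurableType dT} {Omega : measurableType dO} {R : realType}.
Variables (Q : probability T R) (P : probability Omega R).
Variables (G : set (set T)) (xi : T -> Omega).
Hypotheses (Gm : G `<=` measurable) (mxi : measurable_fun setT xi).

Definition indep_of :=
  forall A B, <<s G >> A -> measurable B -> Q (A `&` xi @^-1` B) = (Q A * P B)%E.

Lemma g_sigma_measurable : <<s G >> `<=` measurable.
Proof. by apply: smallest_sub => //; exact: sigma_algebra_measurable. Qed.

Let TG := g_sigma_algebraType G.

Let mid : measurable_fun setT (fun t : T => (t : TG)).
Proof. by move=> _ A mA; rewrite setTI; exact: g_sigma_measurable. Qed.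

Let mpair : measurable_fun setT (fun t : T => ((t : TG), xi t)).
Proof. exact: measurable_fun_pair mid mxi. Qed.

Lemma measurable_indep_comp (f : TG * Omega -> R) :
  measurable_fun setT f -> measurable_fun setT (fun t : T => f ((t : TG), xi t)).
Proof. by move=> mf; exact: (measurableT_comp mf mpair). Qed.

(** [TG] is the sample space with the sigma-algebra generated by [G]. Independence says that the law
    of (t, xi t) on [TG * Omega] is a product on rectangles, hence everywhere; Fubini then
    integrates the sample first. *)
Lemma indep_Rintegral (f : TG * Omega -> R) : indep_of ->
  measurable_fun setT f ->
  Q.-integrable setT (fun t : T => (f ((t : TG), xi t))%:E) ->
  (forall t, P.-integrable setT (fun o => (f (t, o))%:E)) ->
  \int[Q]_t f ((t : TG), xi t) = \int[Q]_t \int[P]_o f ((t : TG), o).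
Proof.
move=> ind mf iQ iP.
pose idm : {mfun T >-> TG} := HB.pack (fun t : T => (t : TG))
  (isMeasurableFun.Build _ _ _ _ _ mid).
pose prm : {mfun T >-> (TG * Omega)%type} := HB.pack (fun t : T => ((t : TG), xi t))
  (isMeasurableFun.Build _ _ _ _ _ mpair).
pose Q1 := distribution Q idm.
pose Q2 := distribution Q prm.
have Q12 A : measurable A -> (Q1 \x P)%E A = Q2 A.
  apply: (@product_measure_unique _ _ _ _ _ Q1 P Q2) => A' B mA mB.
  by rewrite /Q2 /distribution /pushforward/= -ind.
have mEf : measurable_fun setT (EFin \o f) by exact/measurable_EFinP.
have i2 : Q2.-integrable setT (EFin \o f).
  exact: (integrable_pushforward mpair mEf).
have i12 : (Q1 \x P)%E.-integrable setT (EFin \o f).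
  have [_ i2'] := integrableP _ _ _ i2.
  apply/integrableP; split => //; apply: le_lt_trans i2'.
  by rewrite (eq_measure_integral Q2)// => A mA _; exact: Q12.
rewrite /Rintegral; congr fine.
rewrite (_ : \int[Q]_t _ = \int[Q2]_x (f x)%:E)%E; last first.
  by rewrite (integral_pushforward mpair mEf).
rewrite [LHS](eq_measure_integral (Q1 \x P)%E); last by move=> A mA _; exact/esym/Q12.
rewrite -(@integral12_prod_meas1 _ _ _ _ _ Q1 P _ i12).
have mF := @measurable_fubini_F _ _ _ _ _ Q1 P _ i12.
have FE t : fubini_F P (EFin \o f) t = (\int[P]_o f (t, o))%:E.
  by rewrite /fubini_F /Rintegral fineK//; exact: (integrable_fin_num _ (iP t)).
rewrite (@integral_pushforward _ _ T TG R _ mid Q setT (fubini_F P (EFin \o f)))//.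
  by apply: eq_integral => t _ /=; rewrite FE.
have : Q1.-integrable setT (fubini_F P (EFin \o f)).
  exact: (@integrable_fubini_F _ _ _ _ _ Q1 P _ i12).
move=> /integrableP[m1 i1]; apply/integrableP; split.
  exact: measurableT_comp m1 mid.
move: i1; rewrite (@ge0_integral_pushforward _ _ T TG R _ mid Q setT)//.
exact: measurableT_comp.
Qed.

End independence.

Section lipschitz_mean.
Context {d} {Omega : measurableType d} {R : realType} {N : nat}.
Variables (P : probability Omega R) (W : set 'cV[R]_N) (h : Omega -> 'cV[R]_N -> R).
Variables (C B0 : R) (p0 : 'cV[R]_N).
Hypothesis hl : forall o p q, W p -> W q -> `|h o p - h o q| <= C * enorm (p - q).
Hypothesis hm : forall p, W p -> measurable_fun setT (h ^~ p).
Hypotheses (Wp0 : W p0) (hB0 : forall o, `|h o p0| <= B0).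

Let PT : P [set: Omega] = 1%E := probability_setT P.

Lemma lipschitz_bound o p : W p -> `|h o p| <= B0 + `|C| * (enorm p + enorm p0).
Proof.
move=> Wp; rewrite -(subrK (h o p0) (h o p)) addrC.
apply: le_trans (ler_normD _ _) _; apply: lerD => //.
apply: le_trans (hl _ Wp Wp0) _; apply: le_trans (ler_wpM2r (enorm_ge0 _) (ler_norm C)) _.
by rewrite ler_wpM2l// enormB.
Qed.

Lemma lipschitz_essb p : W p -> essb setT (h ^~ p).
Proof.
by move=> Wp; split; [exact: hm|eexists => o _; exact: lipschitz_bound].
Qed.

Lemma lipschitz_mean p q : W p -> W q ->
  `|\int[P]_o h o p - \int[P]_o h o q| <= C * enorm (p - q).
Proof.
move=> Wp Wq; have hp := lipschitz_essb Wp; have hq := lipschitz_essb Wq.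
rewrite -(essb_RintegralB measurableT PT hp hq).
have hpq := essbB hp hq.
have hle (f g : Omega -> R) : essb setT f -> essb setT g ->
    (forall o, f o <= g o) -> \int[P]_o f o <= \int[P]_o g o.
  by move=> ef eg fg; exact: (essb_le_Rintegral measurableT PT ef eg (fun o _ => fg o)).
rewrite ler_norml; apply/andP; split.
  rewrite -[leLHS](probability_Rintegral_cst P); apply: hle => //; first exact: essb_cst.
  by move=> o /=; have := hl o Wp Wq; rewrite ler_norml => /andP[].
rewrite -[leRHS](probability_Rintegral_cst P); apply: hle => //; first exact: essb_cst.
by move=> o /=; have := hl o Wp Wq; rewrite ler_norml => /andP[].
Qed.

End lipschitz_mean.

Section essb_lipschitz_comp.
Context {d} {T : measurableType d} {R : realType} {N : nat}.
Variables (T' : set T) (W : set 'cV[R]_N).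

Lemma essb_lipschitz_comp (H : 'cV[R]_N -> R) (C B : R) (v : T -> 'cV[R]_N) :
  (forall p q, W p -> W q -> `|H p - H q| <= C * enorm (p - q)) ->
  (forall t, W (v t)) -> (forall i, measurable_fun setT (fun t => v t i 0)) ->
  (forall t, T' t -> enorm (v t) <= B) -> essb T' (fun t => H (v t)).
Proof.
move=> hl Wv mv vB; split.
  by apply: (@measurable_lipschitz_comp _ _ _ _ W (fun _ => H) C).
have hb := lipschitz_bound (fun _ : unit => hl) (Wv point) (fun _ => lexx _) tt.
exists (`|H (v point)| + `|C| * (B + enorm (v point))) => t Tt.
apply: le_trans (hb _ (Wv t)) _; rewrite lerD2l ler_wpM2l// lerD2r; exact: vB.
Qed.

End essb_lipschitz_comp.

Lemma measurable_g_sigma {dT} {T : measurableType dT} {R : realType}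
    (G : set (set T)) (f : T -> R) : G `<=` measurable ->
  measurable_fun setT (f : g_sigma_algebraType G -> R) -> measurable_fun setT f.
Proof.
move=> Gm mf _ A mA; have := mf measurableT A mA; rewrite !setTI.
exact: g_sigma_measurable.
Qed.

Section decoupling.
Context {dT dO} {T : measurableType dT} {Omega : measurableType dO} {R : realType} {N : nat}.
Variables (Q : probability T R) (P : probability Omega R) (T' : set T).
Hypotheses (mT' : measurable T') (QT' : Q T' = 1%E).
Variables (G : set (set T)) (xi : T -> Omega).
Hypotheses (Gm : G `<=` measurable) (mxi : measurable_fun setT xi).
Hypothesis ind : indep_of Q P G xi.
Variables (W : set 'cV[R]_N) (h : Omega -> 'cV[R]_N -> R).
Variables (C B0 : R) (p0 : 'cV[R]_N).
Hypothesis hl : forall o p q, W p -> W q -> `|h o p - h o q| <= C * enorm (p - q).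
Hypothesis hm : forall p, W p -> measurable_fun setT (h ^~ p).
Hypotheses (Wp0 : W p0) (hB0 : forall o, `|h o p0| <= B0).
Variables (zeta : T -> R) (v : T -> 'cV[R]_N) (B : R).
Hypothesis mzeta : measurable_fun setT (zeta : g_sigma_algebraType G -> R).
Hypothesis mv : forall i,
  measurable_fun setT ((fun t => v t i 0) : g_sigma_algebraType G -> R).
Hypothesis Wv : forall t, W (v t).
Hypothesis zetaB : forall t, T' t -> `|zeta t| <= B.
Hypothesis vB : forall t, T' t -> enorm (v t) <= B.

Let TG := g_sigma_algebraType G.

(** Plays the part of conditional expectation given the past: [zeta] and [v] are frozen while the
    independent sample is averaged. The Lipschitz dependence on the point supplies the joint
    measurability that Fubini needs. *)
Lemma decoupling :
  [/\ essb T' (fun t => zeta t * h (xi t) (v t)),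
      essb T' (fun t => zeta t * \int[P]_o h o (v t)) &
      \int[Q]_t (zeta t * h (xi t) (v t)) = \int[Q]_t (zeta t * \int[P]_o h o (v t))].
Proof.
have PT : P [set: Omega] = 1%E := probability_setT P.
have mzT : measurable_fun setT zeta.
  exact: measurable_g_sigma Gm mzeta.
have mvT i : measurable_fun setT (fun t => v t i 0).
  exact: measurable_g_sigma Gm (mv i).
have ez : essb T' zeta by split => //; exists B.
have e2 : essb T' (fun t => zeta t * \int[P]_o h o (v t)).
  apply: essbM => //.
  exact: (essb_lipschitz_comp (lipschitz_mean P hl hm Wp0 hB0) Wv mvT vB).
pose f (x : TG * Omega) : R := zeta x.1 * h x.2 (v x.1).
have mf : measurable_fun setT f.
  apply: measurable_funM.
    exact: (measurableT_comp mzeta measurable_fst).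
  apply: (@measurable_lipschitz_comp _ _ _ _ W (fun x : TG * Omega => h x.2) C
            (fun x : TG * Omega => v x.1)) => //.
  - by move=> t p q Wp Wq; exact: hl.
  - by move=> p Wp; exact: (measurableT_comp (hm Wp) measurable_snd).
  - by move=> i; exact: (measurableT_comp (mv i) measurable_fst).
have e1 : essb T' (fun t => zeta t * h (xi t) (v t)).
  split; first exact: (measurable_indep_comp Gm mxi mf).
  exists (B * (B0 + `|C| * (B + enorm p0))) => t Tt.
  rewrite normrM ler_pM ?zetaB//.
  apply: le_trans (lipschitz_bound hl Wp0 hB0 _ (Wv t)) _.
  by rewrite lerD2l ler_wpM2l// lerD2r vB.
split => //.
have eh t := lipschitz_essb hl hm Wp0 hB0 (Wv t).
rewrite (@indep_Rintegral _ _ _ _ _ Q P G xi Gm mxi f ind mf).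
- apply: eq_Rintegral => t _; rewrite -(essb_RintegralZl measurableT PT)//.
- exact: (essb_integrable mT' QT' e1).
- by move=> t; exact: (essb_integrable measurableT PT (essbZ (zeta t) (eh t))).
Qed.

End decoupling.

(** * Independence of a sample from the past *)

Section iid_past.
Context {dT dO} {T : measurableType dT} {Omega : measurableType dO} {R : realType}.
Variables (Q : probability T R) (P : probability Omega R).

Definition past_generators (om : nat -> T -> Omega) (k : nat) : set (set T) :=
  [set S | exists j A, [/\ (2 <= j < k.*2)%N, measurable A & S = om j @^-1` A]].

Variable om : nat -> T -> Omega.
Hypothesis om_iid : iid P Q (fun j => om j.+2).

Lemma measurable_sample j : (2 <= j)%N -> measurable_fun setT (om j).
Proof. by case: j => [|[|j]]// _; case: om_iid => + _ _; exact. Qed.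

Lemma past_generators_measurable k : past_generators om k `<=` measurable.
Proof.
move=> _ [j [A [/andP[j2 _] mA ->]]]; rewrite -[X in measurable X]setTI.
exact: (measurable_sample j2).
Qed.

(** The measures A |-> Q(A and om_l in B) and P(B) Q agree on cylinders, by the product rule.
    Cylinders are stable under intersection and generate a sigma-algebra containing the past, so the
    measures agree there. *)
Lemma indep_of_past k l : (k.*2 <= l)%N -> (2 <= l)%N ->
  indep_of Q P (past_generators om k) (om l).
Proof.
case: om_iid => mxi law prod kl l2.
(* After the shift by 2 the past indices 2, ..., 2k - 1 become 0, ..., n - 1; truncated subtraction
   makes the past empty for k = 0. *)
pose n := (k.*2 - 2)%N; pose xi j := om j.+2.
pose l' := (l - 2)%N.
have xil : om l = xi l' by rewrite /xi /l'; congr (om _); lia.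
have nl : (n <= l')%N by rewrite /n /l'; lia.
have mpre j B : measurable B -> measurable (xi j @^-1` B).
  by move=> mB; rewrite -[X in measurable X]setTI; exact: mxi.
pose cyl (A : nat -> set Omega) := \big[setI/setT]_(j <- iota 0 n) (xi j @^-1` A j).
pose Gp : set (set T) := [set S | exists2 A, (forall j, measurable (A j)) & S = cyl A].
have cylT : cyl (fun _ => setT) = setT.
  by rewrite /cyl big1// => j _; rewrite preimage_setT.
have Gpm : Gp `<=` measurable.
  move=> _ [A mA ->]; rewrite /cyl; apply: bigsetI_measurable => j _; exact: mpre.
have pastGp : past_generators om k `<=` Gp.
  move=> _ [j [A [/andP[j2 jk] mA ->]]].
  exists (fun i => if i == (j - 2)%N then A else setT).
    by move=> i; case: ifP.
  rewrite /cyl (bigD1_seq (j - 2)%N) ?iota_uniq//=; last by rewrite mem_iota /n; lia.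
  rewrite eqxx big1 ?setIT; last by move=> i /negbTE ->; rewrite preimage_setT.
  by rewrite /xi (_ : (j - 2).+2 = j)//; lia.
have pastS : <<s past_generators om k >> `<=` <<s Gp >>.
  apply: smallest_sub; first exact: smallest_sigma_algebra.
  by move=> S /pastGp; exact: sub_sigma_algebra.
move=> A B pA mB; rewrite xil.
have iB : measurable (xi l' @^-1` B) by exact: mpre.
have PBf : P B \is a fin_num by exact: fin_num_measure.
have PB0 : 0 <= fine (P B) by rewrite fine_ge0.
pose m1 : {measure set T -> \bar R} := mrestr Q iB.
pose m2 : {measure set T -> \bar R} := mscale (NngNum PB0) Q.
have : m1 A = m2 A; last by rewrite /m1 /m2/= /mrestr /mscale/= fineK// muleC.
apply: (@g_sigma_algebra_measure_unique _ _ _ Gp Gpm (fun _ => setT)) => //.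
- by move=> _; exists (fun _ => setT).
- by rewrite bigcup_const.
- move=> _ _ [A1 mA1 ->] [A2 mA2 ->]; exists (fun j => A1 j `&` A2 j).
    by move=> j; exact: measurableI.
  by rewrite /cyl -big_split/=; apply: eq_bigr => j _; rewrite preimage_setI.
- move=> _ [A1 mA1 ->]; rewrite /m1 /m2/= /mrestr /mscale/= fineK// muleC.
  (* As l' >= n, the slot l' is free in the cylinder. The product rule with and without this slot
     gives the factorization. *)
  pose A' j := if j == l' then B else A1 j.
  have mA' j : measurable (A' j) by rewrite /A'; case: ifP.
  have l'n : l' \notin iota 0 n by rewrite mem_iota; lia.
  have cylE : cyl A1 = \big[setI/setT]_(j <- iota 0 n) (xi j @^-1` A' j).
    rewrite /cyl big_seq [RHS]big_seq; apply: eq_bigr => j jn; rewrite /A'.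
    by case: eqP => // jl; rewrite -jl jn in l'n.
  have := prod (l' :: iota 0 n) A'; rewrite /= l'n iota_uniq => /(_ isT mA').
  have := prod (iota 0 n) A' (iota_uniq _ _) mA'.
  rewrite !big_cons -/(xi _) => h1; rewrite -h1 -cylE.
  have -> : A' l' = B by rewrite /A' eqxx.
  by rewrite setIC => ->; rewrite muleC [Q (xi l' @^-1` B)](law l' B mB).
- move=> _; change (Q ([set: T] `&` xi l' @^-1` B) < +oo)%E.
  by rewrite setTI ltey_eq fin_num_measure.
- exact: pastS.
Qed.

End iid_past.

(** * CVaR *)

Section cvar.
Context {d} {Omega : measurableType d} {R : realType} {n : nat}.
Variables (P : probability Omega R) (h : Omega -> 'cV[R]_n -> R) (delta : R).
Hypothesis delta01 : 0 <= delta < 1.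
Let kap := (1 - delta)^-1.

Lemma integrable_max_sub (y : Omega -> R) u :
  P.-integrable setT (EFin \o y) ->
  P.-integrable setT (fun o => (Num.max (y o - u) 0)%:E).
Proof.
move=> iy; have my : measurable_fun setT y by case/integrableP: iy => /measurable_EFinP.
apply: (@le_integrable _ _ _ P _ measurableT _ (fun o => `|(y o)%:E| + `|u|%:E)%E) => //.
- apply/measurable_EFinP; apply: measurable_maxr; last exact: measurable_cst.
  by apply: measurable_funB => //; exact: measurable_cst.
- move=> o _ /=; rewrite lee_fin ger0_norm ?le_max ?lexx ?orbT//.
  rewrite [leRHS]ger0_norm ?addr_ge0// ge_max addr_ge0// andbT.
  by apply: le_trans (ler_norm _) _; exact: ler_normB.
- apply: integrableD => //; first exact: integrable_abse.
  exact: finite_measure_integrable_cst.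
Qed.

Section at_point.
Variable x : 'cV[R]_n.
Hypothesis hx : P.-integrable setT (fun o => (h o x)%:E).

Lemma psi_integrable u : P.-integrable setT (fun o => (psi (h o) x u delta)%:E).
Proof.
have -> : (fun o => (psi (h o) x u delta)%:E)
    = (cst u%:E \+ (fun o => kap%:E * (Num.max (h o x - u) 0)%:E))%E by [].
apply: integrableD => //; first exact: finite_measure_integrable_cst.
by apply: integrableZl => //; exact: integrable_max_sub hx.
Qed.

Lemma fine_expectation (y : Omega -> R) : fine ('E_P[y])%E = \int[P]_o y o.
Proof. by rewrite unlock. Qed.

Lemma Rintegral_psi u : \int[P]_o psi (h o) x u delta
  = u + kap * fine ('E_P[(fun o => Num.max (h o x - u) 0)%R])%E.
Proof.
rewrite fine_expectation -RintegralZl//; last exact: integrable_max_sub hx.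
rewrite -[X in X + _](probability_Rintegral_cst P) -RintegralD//.
  exact: finite_measure_integrable_cst.
exact: (integrableZl measurableT kap (integrable_max_sub u hx)).
Qed.

Lemma cvar_le_psi u : cvar P delta (fun o => h o x) <= \int[P]_o psi (h o) x u delta.
Proof.
rewrite Rintegral_psi; apply: ge_inf; last by exists u.
(* The infimum needs a lower bound on its range: the mean of [h], since psi >= h. *)
exists (\int[P]_o h o x) => _ [v _ <-]; rewrite -Rintegral_psi.
apply: le_Rintegral => //; first exact: psi_integrable.
by move=> o _; exact: psi_ge_h.
Qed.

Lemma cvar_ge_psi c : (forall u, c <= \int[P]_o psi (h o) x u delta) ->
  c <= cvar P delta (fun o => h o x).
Proof.
move=> hc; apply: lb_le_inf; first by eexists; exists 0.
by move=> _ [u _ <-]; rewrite -Rintegral_psi.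
Qed.

Lemma cvar_argmin us :
  is_argmin setT (fun u => fine ('E_P[(fun o => psi (h o) x u delta)%R])%E) us ->
  cvar P delta (fun o => h o x) = \int[P]_o psi (h o) x us delta.
Proof.
move=> [_ hmin]; apply/eqP; rewrite eq_le cvar_le_psi/=.
by apply: cvar_ge_psi => u; have := hmin u Logic.I; rewrite !fine_expectation.
Qed.

End at_point.

(** For each fixed u the mean of psi changes by at most [kap * c], and the infimum over u inherits
    this. It makes F and G^i Lipschitz in x, hence measurable along the averaged iterate. *)
Lemma cvar_lipschitz (Om' : set Omega) x y c :
  measurable Om' -> P Om' = 1%E ->
  P.-integrable setT (fun o => (h o x)%:E) -> P.-integrable setT (fun o => (h o y)%:E) ->
  (forall o, Om' o -> `|h o x - h o y| <= c) ->
  `|cvar P delta (fun o => h o x) - cvar P delta (fun o => h o y)| <= kap * c.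
Proof.
move=> mO PO ix iy hc.
have aux a b : P.-integrable setT (fun o => (h o a)%:E) ->
    P.-integrable setT (fun o => (h o b)%:E) ->
    (forall o, Om' o -> `|h o a - h o b| <= c) ->
    cvar P delta (fun o => h o a) - kap * c <= cvar P delta (fun o => h o b).
  move=> ia ib hab; apply: cvar_ge_psi => // u.
  rewrite lerBlDr; apply: le_trans (cvar_le_psi ia u) _.
  rewrite -[X in _ + X](probability_Rintegral_cst P) -RintegralD//; last 2 first.
  - exact: psi_integrable.
  - exact: finite_measure_integrable_cst.
  apply: (le_Rintegral_full mO PO).
  - exact: psi_integrable.
  - have icst : P.-integrable setT (EFin \o cst (kap * c)).
      exact: finite_measure_integrable_cst.
    exact: (integrableD measurableT (psi_integrable ib u) icst).
  move=> o Oo /=; rewrite -lerBlDl -[c in leRHS]addr0.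
  by apply: psi_sub_le => //; [exact: hab|rewrite subrr normr0].
rewrite ler_norml; have := aux _ _ ix iy hc.
have hc' o : Om' o -> `|h o y - h o x| <= c by rewrite distrC; exact: hc.
have := aux _ _ iy ix hc'.
lra.
Qed.

End cvar.

(** * The expected step and the recursion for the multipliers *)

Lemma sum_telescope_le {R : realType} (K : nat) (x g : nat -> R) (c : R) :
  (forall k, (1 <= k <= K)%N -> g k + x k.+1 <= x k + c) ->
  \sum_(1 <= k < K.+1) g k + x K.+1 <= x 1%N + K%:R * c.
Proof.
elim: K => [|K IH] h; first by rewrite big_nil mul0r add0r addr0.
rewrite big_nat_recr//= -natr1 mulrDl mul1r.
have := IH (fun k hk => h k (ltac:(lia))).
have := h K.+1 (ltac:(lia)); lra.
Qed.

(** Bootstrap: the increment bound may itself depend on [B] and may require [x k <= B], provided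
    that [K] increments fit below [B]. *)
Lemma le_of_increments {R : realType} (K : nat) (x : nat -> R) (c B : R) :
  0 <= c -> x 1%N + K%:R * c <= B ->
  (forall k, (1 <= k <= K)%N -> x k <= B -> x k.+1 <= x k + c) ->
  forall k, (1 <= k <= K.+1)%N -> x k <= B.
Proof.
move=> c0 hB h k hk; suff : x k <= x 1%N + k.-1%:R * c.
  move=> /le_trans; apply; apply: le_trans hB; rewrite lerD2l ler_wpM2r// ler_nat; lia.
elim: k hk => // -[_ _|k IH hk]; first by rewrite mul0r addr0.
have xk := IH (ltac:(lia)); rewrite /= -natr1 mulrDl mul1r addrA.
apply: le_trans (h k.+1 (ltac:(lia)) _) _; last by rewrite lerD2r.
apply: le_trans xk _; apply: le_trans hB; rewrite lerD2l ler_wpM2r// ler_nat; lia.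
Qed.

(** Origin of the factors 2 and 4 in P1. After multiplication by 2 (1 - q) and substitution of B (1
    - q), [a] and [c] carry the coefficient 2, [s] carries 4 q, and [u] at most 3 (1 - q); as u, s
    <= o, the last two sum to at most 4 o. *)
Lemma gap_budget {R : realType} (a u o s q c B : R) :
  0 <= q -> q < 1 -> 0 <= u -> u <= o -> s <= o ->
  B * (1 - q) = a + s * (1 + q) + c ->
  a + u + (c + q / 2 * (u + (2 * s + 2 * B))) <= (2 * a + 4 * o + 2 * c) / (2 * (1 - q)).
Proof.
move=> q0 q1 u0 uo so hB; have p0 : 0 < 1 - q by rewrite subr_gt0.
rewrite ler_pdivlMr ?mulr_gt0//.
rewrite (_ : _ * (2 * (1 - q)) = 2 * (1 - q) * (a + u + c)
  + q * (1 - q) * (u + 2 * s) + 2 * q * (B * (1 - q))); last by field.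
rewrite hB.
have h1 : q * s <= q * o by rewrite ler_wpM2l.
have h2 : (1 - q) * u <= (1 - q) * o by rewrite ler_wpM2l// ltW.
have h3 : q * ((1 - q) * u) <= (1 - q) * u by rewrite ler_piMl// ?mulr_ge0// ltW.
have h4 : 0 <= (1 - q) * o by rewrite mulr_ge0 ?(le_trans u0 uo)// ltW.
lra.
Qed.

Lemma leq_index_succ k K : (1 <= k <= K)%N -> (1 <= k.+1 <= K.+1)%N.
Proof. by case/andP. Qed.

Lemma leq_index_widen k K : (1 <= k <= K)%N -> (1 <= k <= K.+1)%N.
Proof. by case/andP=> -> /leqW. Qed.

Section expected_step.
Context {dT dO} {T : measurableType dT} {Omega : measurableType dO} {R : realType}.
Context {N m K : nat}.
Variables (Q : probability T R) (P : probability Omega R) (om : nat -> T -> Omega).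
Hypothesis om_iid : iid P Q (fun j => om j.+2).
Variable Om' : set Omega.
Hypotheses (mOm' : measurable Om') (POm' : P Om' = 1%E).
Variables (E W : set 'cV[R]_N).
Hypotheses (cW : segment_closed W) (WE : W `<=` E).
Variables (ph : Omega -> 'cV[R]_N -> R) (th : Omega -> 'I_m -> 'cV[R]_N -> R).
Variables (Cp : R) (Ct Dt : 'I_m -> R).
Hypothesis iph : forall p, W p -> P.-integrable setT (fun o => (ph o p)%:E).
Hypothesis ith : forall i p, W p -> P.-integrable setT (fun o => (th o i p)%:E).
Hypothesis ph_sub : forall o p s, Om' o -> W p -> subdiff E (ph o) p s -> enorm s <= Cp.
Hypothesis th_sub : forall o i p s, Om' o -> W p ->
  subdiff E (th o i) p s -> enorm s <= Ct i.
Hypothesis ph_lip : forall o p q, Om' o -> W p -> W q ->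
  `|ph o p - ph o q| <= Cp * enorm (p - q).
Hypothesis th_lip : forall o i p q, Om' o -> W p -> W q ->
  `|th o i p - th o i q| <= Ct i * enorm (p - q).
Hypothesis th_bnd : forall o i p, Om' o -> W p -> `|th o i p| <= Dt i.
Variables (gam : R) (w : nat -> T -> 'cV[R]_N) (z : nat -> T -> 'cV[R]_m).
Variables (w1 ws : 'cV[R]_N).
Hypotheses (g0 : 0 < gam) (Ww1 : W w1) (Wws : W ws).
Hypothesis start : forall t, w 1%N t = w1 /\ z 1%N t = 0.
Hypotheses (adw : adapted om K w) (adz : adapted om K z).
Hypothesis steps : forall k t, (1 <= k <= K)%N ->
  primal_step E W (ph (om k.*2 t)) (th (om k.*2 t)) gam (w k t) (z k t) (w k.+1 t) /\
  dual_step (th (om k.*2.+1 t)) gam (w k.+1 t) (z k t) (z k.+1 t).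

Definition mean_ph p := \int[P]_o ph o p.
Definition mean_th i p := \int[P]_o th o i p.

(* Cutting off the null set makes the Lipschitz bounds hold for every sample, hence the
   composites with the iterates measurable. *)
Let cut_ph o p := \1_Om' o * (ph o p - ph o ws).
Let cut_th i o p := \1_Om' o * th o i p.

Let cutE o : Om' o -> (\1_Om' o : R) = 1.
Proof. by move=> Oo; rewrite indicE mem_set. Qed.

Let cut0 o : ~ Om' o -> (\1_Om' o : R) = 0.
Proof. by move=> Oo; rewrite indicE memNset. Qed.

Lemma indic_lipschitz (a b c : R) o : (Om' o -> `|a - b| <= c) -> 0 <= c ->
  `|\1_Om' o * a - \1_Om' o * b| <= c.
Proof.
move=> h c0; have [Oo|nO] := pselect (Om' o).
  by rewrite cutE// !mul1r; exact: h.
by rewrite cut0// !mul0r subrr normr0.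
Qed.

(** A good sample certifies that the bounds involving [Cp], [Ct] and [Dt] are nonnegative, which the
    cut-off integrands need outside [Om']. *)
Let Om'_ex : exists o, Om' o.
Proof.
apply/set0P; apply: contraPneq POm' => ->.
by rewrite measure0 => /eqP; rewrite eqe eq_sym oner_eq0.
Qed.

Let cut_ph_lip o p q : W p -> W q -> `|cut_ph o p - cut_ph o q| <= Cp * enorm (p - q).
Proof.
move=> Wp Wq; have [a Oa] := Om'_ex.
apply: indic_lipschitz; last exact: le_trans (normr_ge0 _) (ph_lip Oa Wp Wq).
move=> Oo; rewrite (_ : _ - _ = ph o p - ph o q); last by ring.
exact: ph_lip.
Qed.

Let cut_th_lip i o p q : W p -> W q ->
  `|cut_th i o p - cut_th i o q| <= Ct i * enorm (p - q).
Proof.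
move=> Wp Wq; have [a Oa] := Om'_ex.
apply: indic_lipschitz; last exact: le_trans (normr_ge0 _) (th_lip i Oa Wp Wq).
by move=> Oo; exact: th_lip.
Qed.

Let measurable_integrable (f : Omega -> R) :
  P.-integrable setT (fun o => (f o)%:E) -> measurable_fun setT f.
Proof. by move=> /integrableP[/measurable_EFinP]. Qed.

Let cut_ph_meas p : W p -> measurable_fun setT (cut_ph^~ p).
Proof.
move=> Wp; apply: measurable_funM; first exact: measurable_indic.
by apply: measurable_funB; apply: measurable_integrable; exact: iph.
Qed.

Let cut_th_meas i p : W p -> measurable_fun setT (cut_th i ^~ p).
Proof.
move=> Wp; apply: measurable_funM; first exact: measurable_indic.
by apply: measurable_integrable; exact: ith.
Qed.

(** The reason for subtracting the value at [ws]: phi itself need not be bounded in omega at any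
    point, but this difference vanishes at [ws] and grows at most linearly away from it. *)
Let cut_ph_bnd o : `|cut_ph o ws| <= 0.
Proof. by rewrite /cut_ph subrr mulr0 normr0. Qed.

Let cut_th_bnd i o p : W p -> `|cut_th i o p| <= Dt i.
Proof.
move=> Wp; rewrite /cut_th; have [a Oa] := Om'_ex.
have := @indic_lipschitz (th o i p) 0 (Dt i) o; rewrite mulr0 !subr0; apply.
  by move=> Oo; exact: th_bnd.
exact: le_trans (normr_ge0 _) (th_bnd i Oa Wp).
Qed.

Let PT : P [set: Omega] = 1%E := probability_setT P.

Let cut_ph_mean p : W p -> \int[P]_o cut_ph o p = mean_ph p - mean_ph ws.
Proof.
move=> Wp; rewrite /mean_ph -RintegralB//; try exact: iph.
apply: (eq_Rintegral_full mOm' POm').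
- exact: (essb_integrable measurableT PT
    (lipschitz_essb cut_ph_lip cut_ph_meas Wws cut_ph_bnd Wp)).
- exact: (integrableB measurableT (iph Wp) (iph Wws)).
- by move=> o Oo; rewrite /cut_ph cutE// mul1r.
Qed.

Let cut_th_mean i p : W p -> \int[P]_o cut_th i o p = mean_th i p.
Proof.
move=> Wp; apply: (eq_Rintegral_full mOm' POm').
- exact: (essb_integrable measurableT PT (lipschitz_essb (cut_th_lip i)
    (cut_th_meas i) Wws (fun o => cut_th_bnd i o Wws) Wp)).
- exact: ith.
- by move=> o Oo; rewrite /cut_th cutE// mul1r.
Qed.

Lemma mean_ph_lip p q : W p -> W q ->
  `|mean_ph p - mean_ph q| <= Cp * enorm (p - q).
Proof.
move=> Wp Wq; have := lipschitz_mean P cut_ph_lip cut_ph_meas Wws cut_ph_bnd Wp Wq.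
by rewrite !cut_ph_mean// opprB addrA subrK.
Qed.

Lemma mean_th_lip i p q : W p -> W q ->
  `|mean_th i p - mean_th i q| <= Ct i * enorm (p - q).
Proof.
move=> Wp Wq; have := lipschitz_mean P (cut_th_lip i) (cut_th_meas i) Wws
  (fun o => cut_th_bnd i o Wws) Wp Wq.
by rewrite !cut_th_mean.
Qed.

(** One event on which the bounds hold at every sample of the run. The shift skips [om 0] and
    [om 1], about which nothing is assumed. *)
Definition good_samples : set T := [set t | forall j, Om' (om j.+2 t)].

Lemma measurable_good_samples : measurable good_samples.
Proof.
have -> : good_samples = \bigcap_j (om j.+2 @^-1` Om').
  by apply/seteqP; split => [t h j _|t h j]; [exact: h|exact: (h j)].
apply: bigcapT_measurable => j; rewrite -[X in measurable X]setTI.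
exact: (measurable_sample om_iid).
Qed.

Lemma good_samples1 : Q good_samples = 1%E.
Proof.
have mO j : measurable (om j.+2 @^-1` Om').
  by rewrite -[X in measurable X]setTI; exact: (measurable_sample om_iid).
have n0 : Q (~` good_samples) = 0%E.
  apply: measure_negligible; first exact/measurableC/measurable_good_samples.
  apply: (@negligibleS _ _ _ _ (\bigcup_j ~` (om j.+2 @^-1` Om'))).
    move=> t /= ht; have [j hj] : exists j, ~ Om' (om j.+2 t) by exact/existsNP.
    by exists j.
  apply: negligible_bigcup => j; apply/negligibleP; first exact: measurableC.
  case: om_iid => _ /(_ j _ mOm') law _.
  by rewrite [LHS]probability_setC// law POm' subee.
rewrite -[good_samples]setCK probability_setC ?n0 ?sube0//.
exact/measurableC/measurable_good_samples.
Qed.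

Let T' := good_samples.
Let mT' : measurable T' := measurable_good_samples.
Let QT' : Q T' = 1%E := good_samples1.

Let good k t : T' t -> (1 <= k)%N -> Om' (om k.*2 t) /\ Om' (om k.*2.+1 t).
Proof.
by move=> Tt; case: k => // k _; split; [exact: (Tt k.*2)|exact: (Tt k.*2.+1)].
Qed.

Lemma iterate_mem k t : (1 <= k <= K.+1)%N -> W (w k t) /\ nonneg (z k t).
Proof.
case: k => // -[_|k kK].
  by have [-> ->] := start t; split => // i; rewrite mxE.
have [p q] := @steps k.+1 t kK.
by split; [exact: primal_step_mem p|exact: dual_step_mem q].
Qed.

(** A crude bound, growing with k: on good samples each move is bounded in terms of the current
    iterate. It serves only to make expectations finite. *)
Lemma iterate_bounded k : (1 <= k <= K.+1)%N ->
  exists B, forall t, T' t -> enorm (w k t) <= B /\ enorm (z k t) <= B.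
Proof.
elim: k => // -[_ _|k IH kK].
  exists (enorm w1) => t _; have [-> ->] := start t.
  by rewrite enorm0; split => //; exact: enorm_ge0.
have kK' : (1 <= k.+1 <= K.+1)%N by lia.
have [B hB] := IH kK'.
exists (B + gam * (Cp + \sum_i B * `|Ct i|) + gam * Num.sqrt (\sum_i Dt i ^+ 2)) => t Tt.
have [hw hz] := hB t Tt; have [Wk zk] := iterate_mem t kK'.
have [Og Og'] := good Tt (ltn0Sn k).
have [p q] := @steps k.+1 t kK.
have h1 := primal_step_move g0 cW Wk zk (fun s => ph_sub Og Wk)
  (fun i s => th_sub Og Wk) p.
have h2 := dual_step_move g0 zk (fun i x => th_bnd i Og') p q.
have hs : \sum_i z k.+1 t i 0 * Ct i <= \sum_i B * `|Ct i|.
  apply: ler_sum => i _; apply: le_trans (ler_norm _) _; rewrite normrM.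
  by rewrite ler_wpM2r//; apply: le_trans (coord_le_enorm _ _) hz.
have hs' : gam * (Cp + \sum_i z k.+1 t i 0 * Ct i) <= gam * (Cp + \sum_i B * `|Ct i|).
  by rewrite ler_pM2l// lerD2l.
have := le_enormB (w k.+2 t) (w k.+1 t).
have := le_enormB (z k.+2 t) (z k.+1 t).
have := enorm_ge0 (w k.+2 t - w k.+1 t).
have : 0 <= gam * Num.sqrt (\sum_i Dt i ^+ 2) by rewrite mulr_ge0 ?sqrtr_ge0// ltW.
by move=> ? ? ? ?; split; lra.
Qed.

Let TG k := g_sigma_algebraType (past_generators om k).

Lemma adapted_measurable M k (v : nat -> T -> 'cV[R]_M) i : adapted om K v ->
  (1 <= k <= K.+1)%N -> measurable_fun setT ((fun t => v k t i 0) : TG k -> R).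
Proof. by move=> av hk _ A mA; rewrite setTI; exact: av. Qed.

Let mT M k (v : nat -> T -> 'cV[R]_M) i : adapted om K v ->
  (1 <= k <= K.+1)%N -> measurable_fun setT (fun t => v k t i 0).
Proof.
move=> av hk; apply: measurable_g_sigma (adapted_measurable i av hk).
exact: (past_generators_measurable om_iid).
Qed.

Lemma essb_w k i : (1 <= k <= K.+1)%N -> essb T' (fun t => w k t i 0).
Proof.
move=> hk; split; first exact: mT.
have [B hB] := iterate_bounded hk; exists B => t /hB[hw _].
exact: le_trans (coord_le_enorm _ _) hw.
Qed.

Lemma essb_z k i : (1 <= k <= K.+1)%N -> essb T' (fun t => z k t i 0).
Proof.
move=> hk; split; first exact: mT.
have [B hB] := iterate_bounded hk; exists B => t /hB[_ hz].
exact: le_trans (coord_le_enorm _ _) hz.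
Qed.

Lemma essb_comp_w (H : 'cV[R]_N -> R) C k :
  (forall p q, W p -> W q -> `|H p - H q| <= C * enorm (p - q)) ->
  (1 <= k <= K.+1)%N -> essb T' (fun t => H (w k t)).
Proof.
move=> hl hk; have [B hB] := iterate_bounded hk.
apply: (essb_lipschitz_comp hl (B := B)).
- by move=> t; case: (iterate_mem t hk).
- by move=> i; exact: mT.
- by move=> t /hB[].
Qed.

Lemma essb_enorm_sqr M (u : 'cV[R]_M) (v : T -> 'cV[R]_M) :
  (forall i, essb T' (fun t => v t i 0)) -> essb T' (fun t => enorm (u - v t) ^+ 2).
Proof.
move=> hv; under eq_fun do rewrite enorm_sqrE.
apply: essb_sum => i; under eq_fun do rewrite !mxE expr2.
by apply: essbM; apply: essbB => //; exact: essb_cst.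
Qed.

Lemma essb_sum_max (z0 : 'cV[R]_m) k : (1 <= k <= K.+1)%N ->
  essb T' (fun t => \sum_i Num.max (z0 i 0) (z k t i 0) ^+ 2).
Proof.
move=> hk; apply: essb_sum => i; under eq_fun do rewrite expr2.
have [mz [B hB]] := essb_z i hk.
have em : essb T' (fun t => Num.max (z0 i 0) (z k t i 0)).
  split; first by apply: measurable_maxr => //; exact: measurable_cst.
  exists (`|z0 i 0| + B) => t Tt; have hz := hB t Tt.
  rewrite /Order.max; case: ifP => _; first exact: le_trans hz (ler_wpDl _ _).
  by rewrite lerDl (le_trans (normr_ge0 _) hz).
exact: essbM.
Qed.

(** The difference L(w_(k+1), z0) - L(w_star, z_k) for the mean functions, along one path. *)
Definition gap (z0 : 'cV[R]_m) k t :=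
  mean_ph (w k.+1 t) - mean_ph ws
  + \sum_i (z0 i 0 * mean_th i (w k.+1 t) - z k t i 0 * mean_th i ws).

Lemma essb_gap z0 k : (1 <= k <= K)%N -> essb T' (gap z0 k).
Proof.
move=> hk; have hk1 := leq_index_succ hk.
have hk0 := leq_index_widen hk.
apply: essbD.
  by apply: essbB; [exact: essb_comp_w mean_ph_lip hk1|exact: essb_cst].
apply: essb_sum => i; apply: essbB.
  by apply: essbZ; exact: essb_comp_w (mean_th_lip i) hk1.
by apply: essbM; [exact: essb_z|exact: essb_cst].
Qed.

Let Ct2 := \sum_i Ct i ^+ 2.
Let Dt2 := \sum_i Dt i ^+ 2.

(** In [step_gap] both samples are evaluated at w_k with weights depending on z_k, all known before
    omega_k is drawn, so [decoupling] replaces them by means. The Lipschitz term [X] then carries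
    the means from w_k to w_(k+1). *)
Lemma expected_step z0 k : nonneg z0 -> (1 <= k <= K)%N ->
  \int[Q]_t (2 * gam * gap z0 k t + enorm (ws - w k.+1 t) ^+ 2
             + enorm (z0 - z k.+1 t) ^+ 2)
  <= \int[Q]_t (enorm (ws - w k t) ^+ 2 + enorm (z0 - z k t) ^+ 2
       + (gam ^+ 2 * Dt2 + 8 * gam ^+ 2 * Cp ^+ 2)
       + 8 * gam ^+ 2 * Ct2 * \sum_i Num.max (z0 i 0) (z k t i 0) ^+ 2).
Proof.
move=> z00 hk; have hk1 := leq_index_succ hk.
have hk0 := leq_index_widen hk.
have k1 : (1 <= k)%N by lia.
have [B hB] := iterate_bounded hk0.
have vB t : T' t -> enorm (w k t) <= B by move=> /hB[].
have zB i t : T' t -> `|z k t i 0| <= B.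
  by move=> /hB[_ hz]; exact: le_trans (coord_le_enorm _ _) hz.
have ind_primal := indep_of_past om_iid (leqnn k.*2) (ltac:(lia) : (2 <= k.*2)%N).
have ind_dual := indep_of_past om_iid (leqnSn k.*2) (ltac:(lia) : (2 <= k.*2.+1)%N).
have mom0 := measurable_sample om_iid (ltac:(lia) : (2 <= k.*2)%N).
have mom1 := measurable_sample om_iid (ltac:(lia) : (2 <= k.*2.+1)%N).
have Gm := @past_generators_measurable _ _ _ _ _ Q P om om_iid k.
have mwk i := adapted_measurable i adw hk0.
have mzk i := adapted_measurable i adz hk0.
have Wk t : W (w k t) by case: (iterate_mem t hk0).
have m1 : measurable_fun setT ((fun _ => 1) : TG k -> R) by exact: measurable_cst.
have B1 t : T' t -> `|1 : R| <= Num.max 1 B by rewrite normr1 le_max lexx.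
have vB1 t : T' t -> enorm (w k t) <= Num.max 1 B.
  by move=> Tt; rewrite le_max vB// orbT.
have [U1 V1 UV1] := decoupling mT' QT' Gm mom0 ind_primal cut_ph_lip cut_ph_meas Wws
  cut_ph_bnd m1 mwk Wk B1 vB1.
pose dth i o p := cut_th i o p - cut_th i o ws.
have dth_lip i o p q : W p -> W q -> `|dth i o p - dth i o q| <= Ct i * enorm (p - q).
  by move=> Wp Wq; rewrite /dth opprB addrA subrK; exact: cut_th_lip.
have dth_meas i p : W p -> measurable_fun setT (dth i ^~ p).
  by move=> Wp; apply: measurable_funB; exact: cut_th_meas.
have dth_bnd i o : `|dth i o ws| <= 0 by rewrite /dth subrr normr0.
have D2 i := decoupling mT' QT' Gm mom0 ind_primal (dth_lip i) (dth_meas i) Wws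
  (dth_bnd i) (mzk i) mwk Wk (zB i) vB.
have m3 i : measurable_fun setT ((fun t => z0 i 0 - z k t i 0) : TG k -> R).
  by apply: measurable_funB => //; exact: measurable_cst.
have B3 i t : T' t -> `|z0 i 0 - z k t i 0| <= enorm z0 + B.
  move=> Tt; apply: le_trans (ler_normB _ _) _.
  by apply: lerD; [exact: coord_le_enorm|exact: zB].
have vB3 t : T' t -> enorm (w k t) <= enorm z0 + B.
  by move=> Tt; apply: le_trans (vB _ Tt) _; rewrite lerDr enorm_ge0.
have D3 i := decoupling mT' QT' Gm mom1 ind_dual (cut_th_lip i) (cut_th_meas i) Wws
  (fun o => cut_th_bnd i o Wws) (m3 i) mwk Wk (B3 i) vB3.
pose U t := 1 * cut_ph (om k.*2 t) (w k t)
  + \sum_i z k t i 0 * dth i (om k.*2 t) (w k t)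
  + \sum_i (z0 i 0 - z k t i 0) * cut_th i (om k.*2.+1 t) (w k t).
pose V t := 1 * \int[P]_o cut_ph o (w k t)
  + \sum_i z k t i 0 * \int[P]_o dth i o (w k t)
  + \sum_i (z0 i 0 - z k t i 0) * \int[P]_o cut_th i o (w k t).
have eU2 : essb T' (fun t => \sum_i z k t i 0 * dth i (om k.*2 t) (w k t)).
  by apply: essb_sum => i; case: (D2 i).
have eU3 : essb T' (fun t =>
    \sum_i (z0 i 0 - z k t i 0) * cut_th i (om k.*2.+1 t) (w k t)).
  by apply: essb_sum => i; case: (D3 i).
have eV2 : essb T' (fun t => \sum_i z k t i 0 * \int[P]_o dth i o (w k t)).
  by apply: essb_sum => i; case: (D2 i).
have eV3 : essb T' (fun t =>
    \sum_i (z0 i 0 - z k t i 0) * \int[P]_o cut_th i o (w k t)).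
  by apply: essb_sum => i; case: (D3 i).
have eU : essb T' U by apply: essbD => //; exact: essbD.
have eV : essb T' V by apply: essbD => //; exact: essbD.
have UV : \int[Q]_t U t = \int[Q]_t V t.
  rewrite !(essb_RintegralD mT' QT')//; try exact: essbD.
  rewrite UV1; congr (_ + _ + _).
    rewrite !(essb_Rintegral_sum mT' QT'); try by move=> i; case: (D2 i).
    by apply: eq_bigr => i _; case: (D2 i).
  rewrite !(essb_Rintegral_sum mT' QT'); try by move=> i; case: (D3 i).
  by apply: eq_bigr => i _; case: (D3 i).
pose X t := 2 * gam * (mean_ph (w k.+1 t) - mean_ph (w k t)
     + \sum_i z0 i 0 * (mean_th i (w k.+1 t) - mean_th i (w k t)))
  + enorm (ws - w k.+1 t) ^+ 2 + enorm (z0 - z k.+1 t) ^+ 2.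
have eX : essb T' X.
  apply: essbD; last by apply: essb_enorm_sqr => i; exact: essb_z.
  apply: essbD; last by apply: essb_enorm_sqr => i; exact: essb_w.
  apply: essbZ; apply: essbD.
    by apply: essbB; apply: essb_comp_w mean_ph_lip _.
  apply: essb_sum => i; apply: essbZ.
  by apply: essbB; apply: essb_comp_w (mean_th_lip i) _.
(* For each i the three terms z_k (th w_k - th ws), (z0 - z_k) th w_k and z0 (th w_(k+1) - th w_k)
   add up to z0 th w_(k+1) - z_k th ws. *)
have VX t : 2 * gam * V t + X t = 2 * gam * gap z0 k t + enorm (ws - w k.+1 t) ^+ 2
    + enorm (z0 - z k.+1 t) ^+ 2.
  rewrite /X !addrA; congr (_ + _ + _); rewrite -mulrDr; congr (_ * _).
  have dthE i : \int[P]_o dth i o (w k t) = mean_th i (w k t) - mean_th i ws.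
    have ec p : W p -> essb setT (cut_th i ^~ p).
      move=> Wp; apply: (lipschitz_essb (cut_th_lip i) (cut_th_meas i) Wws _ Wp).
      by move=> o; exact: cut_th_bnd.
    rewrite (essb_RintegralB measurableT PT (ec _ (Wk t)) (ec _ Wws)).
    by rewrite !cut_th_mean.
  rewrite /V /gap cut_ph_mean//.
  rewrite (eq_bigr (fun i => z k t i 0 * (mean_th i (w k t) - mean_th i ws))); last first.
    by move=> i _; rewrite dthE.
  rewrite [X in _ + X + _ = _](eq_bigr (fun i =>
    (z0 i 0 - z k t i 0) * mean_th i (w k t))); last by move=> i _; rewrite cut_th_mean.
  have -> : \sum_i (z0 i 0 * mean_th i (w k.+1 t) - z k t i 0 * mean_th i ws)
     = \sum_i z k t i 0 * (mean_th i (w k t) - mean_th i ws)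
     + \sum_i (z0 i 0 - z k t i 0) * mean_th i (w k t)
     + \sum_i z0 i 0 * (mean_th i (w k.+1 t) - mean_th i (w k t)).
    by rewrite -!big_split/=; apply: eq_bigr => i _; ring.
  ring.
under eq_Rintegral do rewrite -VX.
rewrite (essb_RintegralD mT' QT' (essbZ _ eV) eX) (essb_RintegralZl mT' QT')//.
rewrite -UV -(essb_RintegralZl mT' QT')// -(essb_RintegralD mT' QT' (essbZ _ eU) eX).
apply: (essb_le_Rintegral mT' QT').
- by apply: essbD => //; exact: essbZ.
- apply: essbD; [apply: essbD; [apply: essbD|exact: essb_cst]|].
  + by apply: essb_enorm_sqr => i; exact: essb_w.
  + by apply: essb_enorm_sqr => i; exact: essb_z.
  + by apply: essbZ; exact: essb_sum_max.
move=> t Tt; have [Og Og'] := good Tt k1.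
have [Wkt zk] := iterate_mem t hk0.
have [p q] := @steps k t hk.
have := step_gap g0 cW WE Wkt zk (fun s => ph_sub Og Wkt) (fun i s => th_sub Og Wkt)
  (fun i x => th_bnd i Og') p q Wws z00 (fun i x y => th_lip i Og') mean_ph_lip mean_th_lip.
have -> : ph (om k.*2 t) (w k t) - ph (om k.*2 t) ws
    + \sum_i z k t i 0 * (th (om k.*2 t) i (w k t) - th (om k.*2 t) i ws)
    + \sum_i (z0 i 0 - z k t i 0) * th (om k.*2.+1 t) i (w k t) = U t.
  rewrite /U /cut_ph /dth /cut_th !cutE// !mul1r; congr (_ + _ + _).
    by apply: eq_bigr => i _; rewrite !mul1r.
  by apply: eq_bigr => i _; rewrite !mul1r.
rewrite /X -/Ct2 -/Dt2; lra.
Qed.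


(** * Uniform bound on the multipliers and the summed gap *)

Variables (zs : 'cV[R]_m) (Ls q : R).
Hypothesis zs0 : nonneg zs.
Hypothesis saddle_le : forall z0, nonneg z0 ->
  mean_ph ws + \sum_i z0 i 0 * mean_th i ws <= Ls.
Hypothesis saddle_ge : forall p, W p -> Ls <= mean_ph p + \sum_i zs i 0 * mean_th i p.
Hypotheses (hq : 16 * K%:R * gam ^+ 2 * Ct2 <= q) (q1 : q < 1).

Let dw k := \int[Q]_t enorm (ws - w k t) ^+ 2.
Let dz z0 k := \int[Q]_t enorm (z0 - z k t) ^+ 2.
Let c0 := gam ^+ 2 * Dt2 + 8 * gam ^+ 2 * Cp ^+ 2.
Let kp := 8 * gam ^+ 2 * Ct2.

Let Ct2_ge0 : 0 <= Ct2. Proof. by apply: sumr_ge0 => i _; exact: sqr_ge0. Qed.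

Let Dt2_ge0 : 0 <= Dt2. Proof. by apply: sumr_ge0 => i _; exact: sqr_ge0. Qed.

Let kp0 : 0 <= kp.
Proof. by rewrite mulr_ge0// mulr_ge0// sqr_ge0. Qed.

Let Kkp : K%:R * kp <= q / 2.
Proof. by move: hq; rewrite /kp; lra. Qed.

Let c0_ge0 : 0 <= c0.
Proof.
have := mulr_ge0 (sqr_ge0 gam) Dt2_ge0; have := mulr_ge0 (sqr_ge0 gam) (sqr_ge0 Cp).
rewrite /c0; lra.
Qed.

Let dz_ge0 z0 k : 0 <= dz z0 k.
Proof. by apply: Rintegral_ge0 => t _; exact: sqr_ge0. Qed.

Let dw_ge0 k : 0 <= dw k.
Proof. by apply: Rintegral_ge0 => t _; exact: sqr_ge0. Qed.

Let dw1 : dw 1 = enorm (w1 - ws) ^+ 2.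
Proof.
rewrite /dw -(probability_Rintegral_cst Q (enorm (w1 - ws) ^+ 2)).
by apply: eq_Rintegral => t _; rewrite (start t).1 enormC.
Qed.

Let dz1 z0 : dz z0 1 = enorm z0 ^+ 2.
Proof.
rewrite /dz -(probability_Rintegral_cst Q (enorm z0 ^+ 2)).
by apply: eq_Rintegral => t _; rewrite (start t).2 subr0.
Qed.

Let essb_dw k : (1 <= k <= K.+1)%N -> essb T' (fun t => enorm (ws - w k t) ^+ 2).
Proof. by move=> hk; apply: essb_enorm_sqr => i; exact: essb_w. Qed.

Let essb_dz z0 k : (1 <= k <= K.+1)%N -> essb T' (fun t => enorm (z0 - z k t) ^+ 2).
Proof. by move=> hk; apply: essb_enorm_sqr => i; exact: essb_z. Qed.

Let step_le z0 k Y : nonneg z0 -> (1 <= k <= K)%N -> essb T' Y ->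
  (forall t, T' t -> \sum_i Num.max (z0 i 0) (z k t i 0) ^+ 2 <= Y t) ->
  2 * gam * \int[Q]_t gap z0 k t + (dw k.+1 + dz z0 k.+1)
    <= dw k + dz z0 k + (c0 + kp * \int[Q]_t Y t).
Proof.
move=> z00 hk eY hY.
have hk1 := leq_index_succ hk.
have hk0 := leq_index_widen hk.
have eg := essb_gap z0 hk.
have e1 := essb_dw hk1; have e2 := essb_dz z0 hk1.
have e3 := essb_dw hk0; have e4 := essb_dz z0 hk0.
have e34 := essbD e3 e4; have e34c := essbD e34 (essb_cst T' c0).
have <- : \int[Q]_t (2 * gam * gap z0 k t + enorm (ws - w k.+1 t) ^+ 2
    + enorm (z0 - z k.+1 t) ^+ 2) = 2 * gam * \int[Q]_t gap z0 k t + (dw k.+1 + dz z0 k.+1).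
  rewrite (essb_RintegralD mT' QT' (essbD (essbZ _ eg) e1) e2).
  by rewrite (essb_RintegralD mT' QT' (essbZ _ eg) e1) (essb_RintegralZl mT' QT' _ eg) addrA.
have <- : \int[Q]_t (enorm (ws - w k t) ^+ 2 + enorm (z0 - z k t) ^+ 2 + c0 + kp * Y t)
    = dw k + dz z0 k + (c0 + kp * \int[Q]_t Y t).
  rewrite (essb_RintegralD mT' QT' e34c (essbZ kp eY)).
  rewrite (essb_RintegralD mT' QT' e34 (essb_cst T' c0)) (essb_RintegralD mT' QT' e3 e4).
  by rewrite (essb_RintegralZl mT' QT' _ eY) probability_Rintegral_cst -(addrA _ c0).
apply: le_trans (expected_step z00 hk) _.
apply: (essb_le_Rintegral mT' QT').
- by apply: essbD => //; apply: essbZ; exact: essb_sum_max.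
- by apply: essbD => //; exact: essbZ.
by move=> t Tt; rewrite lerD2l ler_wpM2l// hY.
Qed.

Let o2 := enorm (const_mx 1 + zs) ^+ 2.
Let zs2 := enorm zs ^+ 2.
Let a1 := enorm (w1 - ws) ^+ 2.
(** Solution of the closed loop: each step adds at most c0 + kp (2 zs2 + 2 B), and as K kp <= q / 2,
    K steps from a1 + zs2 stay below B exactly when B solves the equation [BE] or exceeds its
    solution. *)
Let B := (a1 + zs2 * (1 + q) + K%:R * c0) / (1 - q).

Let q0 : 0 <= q.
Proof.
by apply: le_trans hq; rewrite mulr_ge0// mulr_ge0 ?sqr_ge0// mulr_ge0.
Qed.

Let BE : B = a1 + zs2 + K%:R * c0 + q / 2 * (2 * zs2 + 2 * B).
Proof.
have : B * (1 - q) = a1 + zs2 * (1 + q) + K%:R * c0.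
  by rewrite /B mulfVK// gt_eqF// subr_gt0.
lra.
Qed.

Let B0 : 0 <= B.
Proof.
have h1 : 0 <= zs2 * (1 + q) by rewrite mulr_ge0 ?sqr_ge0// addr_ge0.
have h2 : 0 <= K%:R * c0 by rewrite mulr_ge0.
have h3 : 0 <= a1 by exact: sqr_ge0.
by rewrite /B divr_ge0 ?subr_ge0 ?(ltW q1)// (addr_ge0 (addr_ge0 h3 h1) h2).
Qed.

Let gap_zs_ge0 k t : (1 <= k <= K)%N -> 0 <= gap zs k t.
Proof.
move=> hk; have hk1 := leq_index_succ hk.
have hk0 := leq_index_widen hk.
rewrite /gap sumrB.
have := saddle_ge (iterate_mem t hk1).1; have := saddle_le (iterate_mem t hk0).2.
lra.
Qed.

Let dz_zs_le k : (1 <= k <= K.+1)%N -> dz zs k <= B.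
Proof.
move=> hk; apply: le_trans (_ : dw k + dz zs k <= _); first by rewrite lerDr.
apply: (@le_of_increments _ K (fun k => dw k + dz zs k)
   (c0 + kp * (2 * zs2 + 2 * B)) B) => //.
- by rewrite addr_ge0// mulr_ge0// addr_ge0// mulr_ge0// sqr_ge0.
- rewrite dw1 dz1 -/a1 -/zs2 [leRHS]BE.
  have : K%:R * kp * (2 * zs2 + 2 * B) <= q / 2 * (2 * zs2 + 2 * B).
    by rewrite ler_wpM2r// addr_ge0// mulr_ge0// sqr_ge0.
  lra.
move=> j hj xj; have hj0 := leq_index_widen hj.
(* In the coordinates with z >= zs the slack of this bound is the square of 2 zs - z. *)
pose Y t := 2 * zs2 + 2 * enorm (zs - z j t) ^+ 2.
have eY : essb T' Y by apply: essbD; [exact: essb_cst|apply: essbZ; exact: essb_dz].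
have hY t : T' t -> \sum_i Num.max (zs i 0) (z j t i 0) ^+ 2 <= Y t.
  move=> Tt; rewrite /Y /zs2 !enorm_sqrE !mulr_sumr -big_split/=.
  apply: ler_sum => i _; rewrite !mxE.
  have := sqr_ge0 (zs i 0); have := sqr_ge0 (zs i 0 - z j t i 0).
  have := sqr_ge0 (2 * zs i 0 - z j t i 0).
  rewrite /Order.max; case: ifP => _; lra.
have := step_le zs0 hj eY hY.
have -> : \int[Q]_t Y t = 2 * zs2 + 2 * dz zs j.
  have ed := essb_dz zs hj0.
  rewrite (essb_RintegralD mT' QT' (essb_cst T' (2 * zs2)) (essbZ 2 ed)).
  by rewrite (essb_RintegralZl mT' QT' _ ed) probability_Rintegral_cst.
move=> hst; apply: le_trans (_ : 2 * gam * \int[Q]_t gap zs j t + (dw j.+1 + dz zs j.+1) <= _).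
  rewrite lerDr mulr_ge0 ?(ltW (mulr_gt0 _ g0))//.
  by apply: Rintegral_ge0 => t _; exact: gap_zs_ge0.
apply: le_trans hst _; rewrite !lerD2l ler_wpM2l// lerD2l ler_pM2l//.
by apply: le_trans xj; rewrite lerDr.
Qed.

Let dz0_le k : (1 <= k <= K.+1)%N -> dz 0 k <= 2 * zs2 + 2 * B.
Proof.
move=> hk; apply: le_trans (_ : 2 * zs2 + 2 * dz zs k <= _); last first.
  by rewrite lerD2l ler_pM2l// dz_zs_le.
have ed := essb_dz zs hk.
rewrite -[X in _ <= X + _](probability_Rintegral_cst Q) -(essb_RintegralZl mT' QT')//.
rewrite -(essb_RintegralD mT' QT' (essb_cst _ _) (essbZ _ ed)).
apply: (essb_le_Rintegral mT' QT'); first exact: essb_dz.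
  by apply: essbD; [exact: essb_cst|exact: essbZ].
move=> t _ /=; rewrite /zs2 !enorm_sqrE !mulr_sumr -big_split/=.
apply: ler_sum => i _; rewrite !mxE.
have := sqr_ge0 (2 * zs i 0 - z k t i 0); lra.
Qed.

(** [o2] dominates |z0|^2 for the comparison points used later, 0 and z_star + e_i, so one constant
    serves all claims. Here max (z0, z_k)^2 <= z0^2 + z_k^2, with the uniform bound on E|z_k|^2
    inserted. *)
Lemma sum_gap_le z0 : nonneg z0 -> enorm z0 ^+ 2 <= o2 -> zs2 <= o2 ->
  2 * gam * \sum_(1 <= k < K.+1) \int[Q]_t gap z0 k t
    <= (2 * a1 + 4 * o2 + 2 * (K%:R * c0)) / (2 * (1 - q)).
Proof.
move=> z00 z0o zso.
have z2 : 0 <= enorm z0 ^+ 2 := sqr_ge0 _.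
have zs20 : 0 <= zs2 := sqr_ge0 _.
pose c := c0 + kp * (enorm z0 ^+ 2 + (2 * zs2 + 2 * B)).
have hs k : (1 <= k <= K)%N -> 2 * gam * \int[Q]_t gap z0 k t
    + (dw k.+1 + dz z0 k.+1) <= dw k + dz z0 k + c.
  move=> hk; have hk0 := leq_index_widen hk.
  pose Y t := enorm z0 ^+ 2 + enorm (0 - z k t) ^+ 2.
  have ed := essb_dz 0 hk0.
  have eY : essb T' Y by apply: essbD; [exact: essb_cst|].
  have hY t : T' t -> \sum_i Num.max (z0 i 0) (z k t i 0) ^+ 2 <= Y t.
    move=> Tt; rewrite /Y !enorm_sqrE -big_split/=.
    apply: ler_sum => i _; rewrite !mxE.
    have := sqr_ge0 (z0 i 0); have := sqr_ge0 (z k t i 0).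
    rewrite /Order.max; case: ifP => _; lra.
  apply: le_trans (step_le z00 hk eY hY) _; rewrite lerD2l lerD2l ler_wpM2l//.
  rewrite (essb_RintegralD mT' QT' (essb_cst _ _) ed) probability_Rintegral_cst.
  by rewrite lerD2l dz0_le.
have := sum_telescope_le hs; rewrite -mulr_sumr dw1 dz1 -/a1 => h.
apply: le_trans (_ : a1 + enorm z0 ^+ 2 + K%:R * c <= _).
  by apply: le_trans h; rewrite lerDl addr_ge0.
have hB : B * (1 - q) = a1 + zs2 * (1 + q) + K%:R * c0.
  by rewrite /B mulfVK// gt_eqF// subr_gt0.
apply: le_trans (gap_budget q0 q1 z2 z0o zso hB).
rewrite lerD2l /c mulrDr lerD2l mulrA ler_wpM2r//.
by apply: addr_ge0 => //; apply: addr_ge0; apply: mulr_ge0.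
Qed.

End expected_step.

(** * Constants and averages *)

Section constants.
Context {R : realType} {m : nat}.
Variable beta : 'cV[R]_m.
Hypothesis beta01 : forall i, 0 <= beta i 0 < 1.

Let dbeta : 'M[R]_m := diag_mx (const_mx 1 - beta)^T.

Lemma invmx_diag_mul (v : 'cV[R]_m) :
  invmx dbeta *m v = \col_i ((1 - beta i 0)^-1 * v i 0).
Proof.
have b0 i : 1 - beta i 0 != 0 by rewrite gt_eqF// subr_gt0; case/andP: (beta01 i).
pose ivb : 'rV[R]_m := \row_i (1 - beta i 0)^-1.
have dd : dbeta *m diag_mx ivb = 1%:M.
  apply/matrixP => i j; rewrite /dbeta mul_diag_mx !mxE; case: eqP => [->|_].
    by rewrite !mulr1n mulfV.
  by rewrite !mulr0n mulr0.
have [ud _] := mulmx1_unit dd.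
have -> : invmx dbeta = diag_mx ivb by rewrite -(mulKmx ud (diag_mx ivb)) dd mulmx1.
by rewrite mul_diag_mx; apply/matrixP => i j; rewrite !mxE (ord1 j).
Qed.

Lemma const_P2E alpha CF (DG : 'cV[R]_m) :
  const_P2 alpha CF beta DG = 16 * (CF ^+ 2 + 1) / (1 - alpha) ^+ 2
    + 2 * \sum_i ((1 + beta i 0) / (1 - beta i 0) * DG i 0) ^+ 2.
Proof.
rewrite /const_P2 -mulmxA invmx_diag_mul enorm_sqrE; congr (_ + 2 * _).
apply: eq_bigr => i _; rewrite mul_diag_mx !mxE; congr (_ ^+ 2).
by rewrite mulrA.
Qed.

Lemma const_P3E (CG : 'cV[R]_m) :
  const_P3 beta CG = 16 * m%:R
    * \sum_i (Num.sqrt (CG i 0 ^+ 2 + 1) * (1 - beta i 0)^-1) ^+ 2.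
Proof.
rewrite /const_P3; congr (_ * _); rewrite !invmx_diag_mul enorm_sqrE big_split_ord/=.
rewrite -big_split/=; apply: eq_bigr => i _; rewrite col_mxEu col_mxEd !mxE.
rewrite [in RHS]exprMn sqr_sqrtr ?addr_ge0 ?sqr_ge0//; ring.
Qed.

Lemma lt_sqrt_inv_sqr_mul (x P : R) : 0 <= P -> 0 < x < (Num.sqrt P)^-1 -> x ^+ 2 * P < 1.
Proof.
move=> P0 /andP[x0 xP].
(* For P = 0 the inverse is 0 by convention, and 0 < x < 0 is absurd. *)
have [PE|Pn] := eqVneq P 0; first by move: xP; rewrite PE sqrtr0 invr0 ltNge ltW.
have s0 : 0 < Num.sqrt P by rewrite sqrtr_gt0 lt_neqAle eq_sym Pn.
rewrite -[P]sqr_sqrtr// -exprMn expr_lt1 ?mulr_ge0 ?sqrtr_ge0 ?ltW//.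
by rewrite -ltr_pdivlMr// mul1r.
Qed.

End constants.

(** In use, [A] quantifies over all x in X and need not define a measurable set, hence the passage
    to a measurable subset of full probability. *)
Lemma ae_full_set {d} {T : measurableType d} {R : realType} (P : probability T R)
    (A : T -> Prop) : {ae P, forall t, A t} ->
  exists T' : set T, [/\ measurable T', P T' = 1%E & forall t, T' t -> A t].
Proof.
move=> [N [mN PN sN]]; exists (~` N); split; first exact: measurableC.
  by rewrite probability_setC// PN sube0.
by move=> t Nt; apply: contrapT => nA; apply: Nt; exact: sN.
Qed.

(** A subgradient at x bounds h x - h y, and one at y bounds the opposite difference. *)
Lemma lipschitz_of_subdiff {R : realType} {n : nat} (X D : set 'cV[R]_n)
    (h : 'cV[R]_n -> R) (C : R) : X `<=` D ->
  (forall x, X x -> subdiff D h x !=set0) ->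
  (forall x, X x -> forall s, subdiff D h x s -> enorm s <= C) ->
  forall x y, X x -> X y -> `|h x - h y| <= C * enorm (x - y).
Proof.
move=> XD hne hC.
have aux x y : X x -> X y -> h x - h y <= C * enorm (x - y).
  move=> Xx Xy; have [s hs] := hne x Xx.
  have := hs y (XD _ Xy); have := dotv_ge s (y - x); rewrite (enormC y x).
  have : enorm s * enorm (x - y) <= C * enorm (x - y).
    by rewrite ler_wpM2r ?enorm_ge0//; exact: hC Xx _ hs.
  lra.
move=> x y Xx Xy; rewrite ler_norml aux// andbT lerNl opprB enormC.
exact: aux.
Qed.

Lemma Rintegral_sum {d} {T : measurableType d} {R : realType}
    (mu : {measure set T -> \bar R}) (I : Type) (r : seq I) (F : I -> T -> R) :
  (forall i, mu.-integrable setT (fun t => (F i t)%:E)) ->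
  mu.-integrable setT (fun t => (\sum_(i <- r) F i t)%:E) /\
  \int[mu]_t (\sum_(i <- r) F i t) = \sum_(i <- r) \int[mu]_t F i t.
Proof.
move=> hF; elim: r => [|i r [IH1 IH2]].
  split; first by under eq_fun do rewrite big_nil; exact: integrable0.
  under eq_Rintegral do rewrite big_nil.
  by rewrite big_nil /Rintegral integral0_eq.
split; first by under eq_fun do rewrite big_cons; exact: (integrableD measurableT (hF i) IH1).
rewrite big_cons -IH2 -RintegralD//; last exact: hF.
by apply: eq_Rintegral => t _; rewrite big_cons.
Qed.

Lemma essb_enorm_bounded {d} {T : measurableType d} {R : realType} {N : nat}
    (T' : set T) (v : T -> 'cV[R]_N) :
  (forall i, essb T' (fun t => v t i 0)) -> exists B, forall t, T' t -> enorm (v t) <= B.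
Proof.
move=> hv; have hB i : exists B, forall t, T' t -> `|v t i 0| <= B by case: (hv i).
have /choice[B hBi] := hB.
exists (\sum_i B i) => t Tt; apply: le_trans (enorm_le_l1 _) _.
by apply: ler_sum => i _; exact: hBi.
Qed.

(* Convexity of the mean in (x, u), then minimization over u. *)
Lemma cvar_avg_le {d} {Omega : measurableType d} {R : realType} {n K : nat}
    (P : probability Omega R) (X D : set 'cV[R]_n) (h : Omega -> 'cV[R]_n -> R)
    (delta : R) (x : 'I_K -> 'cV[R]_n) (u : 'I_K -> R) :
  0 <= delta < 1 -> (0 < K)%N -> X `<=` D ->
  (forall x, X x -> P.-integrable setT (fun o => (h o x)%:E)) ->
  (forall o x, X x -> subdiff D (h o) x !=set0) ->
  (forall k, X (x k)) -> X (K%:R^-1 *: \sum_k x k) ->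
  cvar P delta (fun o => h o (K%:R^-1 *: \sum_k x k))
    <= K%:R^-1 * \sum_k \int[P]_o psi (h o) (x k) (u k) delta.
Proof.
move=> d01 K0 XD ih hne Xx Xxb.
apply: le_trans (cvar_le_psi d01 (ih _ Xxb) (K%:R^-1 * \sum_k u k)) _.
have ip k := psi_integrable delta (ih _ (Xx k)) (u k).
have [isum sE] := @Rintegral_sum _ _ _ P _ (index_enum 'I_K) _ ip.
rewrite -sE -RintegralZl//; apply: le_Rintegral => //.
- exact: (psi_integrable delta (ih _ Xxb) (K%:R^-1 * \sum_k u k)).
- exact: (integrableZl measurableT K%:R^-1 isum).
by move=> o _; apply: (@psi_jensen R n K D) => // [k|]; [exact/XD|exact: hne].
Qed.

(** * Duality, averaging and the two convergence rates *)

Theorem theorem3p1 (R : realType) (n m K : nat)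
    (dO : measure_display) (Omega : measurableType dO) (P : probability Omega R)
    (dT : measure_display) (T : measurableType dT) (Q : probability T R)
    (* D is the domain on which the functions are convex; subgradients are taken
       with respect to it (D = X and D = R^n are both allowed) *)
    (X D : set 'cV[R]_n)
    (f : Omega -> 'cV[R]_n -> R) (g : Omega -> 'I_m -> 'cV[R]_n -> R)
    (alpha CF gamma : R) (beta CG DG : 'cV[R]_m)
    (xs : 'cV[R]_n) (zs : 'cV[R]_m) (u0s : R) (us : 'cV[R]_m)
    (om : nat -> T -> Omega) (w1 : 'cV[R]_(n + 1 + m))
    (w : nat -> T -> 'cV[R]_(n + 1 + m)) (z : nat -> T -> 'cV[R]_m) :
  let F := fun x => cvar P alpha (fun o => f o x) in
  let G := fun i x => cvar P (beta i 0) (fun o => g o i x) in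
  (* the problem *)
  closed X -> convex_set X -> convex_set D -> X `<=` D ->
  (forall o, convex_function D (f o)) ->
  (forall o i, convex_function D (g o i)) ->
  (forall o x, X x -> subdiff D (f o) x !=set0) ->
  (forall o i x, X x -> subdiff D (g o i) x !=set0) ->
  (forall x, X x -> P.-integrable setT (fun o => (f o x)%:E)) ->
  (forall i x, X x -> P.-integrable setT (fun o => (g o i x)%:E)) ->
  0 <= alpha < 1 ->
  (forall i, 0 <= beta i 0 < 1) ->
  (* (a) *)
  {ae P, forall o, forall x, X x ->
    forall s, subdiff D (f o) x s -> enorm s <= CF} ->
  (forall i, {ae P, forall o, forall x, X x ->
    forall s, subdiff D (g o i) x s -> enorm s <= CG i 0}) ->
  (* (b) *)
  (forall i, {ae P, forall o, forall x, X x -> `|g o i x| <= DG i 0}) ->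
  (* (c) *)
  is_saddle_point X (fun x v => F x + \sum_(i < m) v i 0 * G i x) xs zs ->
  (* the point w_star *)
  is_argmin setT (fun u => fine ('E_P[(fun o => psi (f o) xs u alpha)%R])%E) u0s ->
  Uset DG us ->
  (forall i, is_argmin setT
    (fun u => fine ('E_P[(fun o => psi (g o i) xs u (beta i 0))%R])%E) (us i 0)) ->
  (* the method *)
  (0 < K)%N ->
  0 < gamma < (Num.sqrt (const_P3 beta CG))^-1 ->
  iid P Q (fun j => om j.+2) ->
  primal_dual_run K D X f g alpha beta DG
    (fun _ => gamma / Num.sqrt K%:R) om w1 w z ->
  let pstar := inf [set F x | x in [set x | X x /\ forall i, G i x <= 0]] in
  let xbar := fun t => K%:R^-1 *: \sum_(1 <= k < K.+1) wx (w k.+1 t) in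
  let eta := (const_P1 w1 (mkw xs u0s us) zs
              + gamma ^+ 2 * const_P2 alpha CF beta DG)
             / (4 * gamma * (1 - gamma ^+ 2 * const_P3 beta CG)) in
  [/\ Q.-integrable setT (fun t => (F (xbar t))%:E),
      forall i, Q.-integrable setT (fun t => (G i (xbar t))%:E),
      ('E_Q[fun t => F (xbar t)] - pstar%:E <= (eta / Num.sqrt K%:R)%:E)%E &
      forall i, ('E_Q[fun t => G i (xbar t)] <= (eta / Num.sqrt K%:R)%:E)%E].
Proof.
move=> F G clX cvX cvD XD cvf cvg nef neg0 intf intg alpha01 beta01 hCF hCG hDG saddle
  u0s_min us_U us_min K0 gamma_bnd om_iid run pstar xbar eta.
have [Xxs zs0 hsad] := saddle.
have [Ww1 start [adw adz] run_steps] := run.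
have [g0 gP] := andP gamma_bnd.
have [Om' [mOm' POm' hOm']] : exists Om' : set Omega, [/\ measurable Om', P Om' = 1%E &
    forall o, Om' o -> (forall x, X x -> forall s, subdiff D (f o) x s -> enorm s <= CF) /\
      forall i, (forall x, X x -> forall s, subdiff D (g o i) x s -> enorm s <= CG i 0) /\
        forall x, X x -> `|g o i x| <= DG i 0].
  pose Ag i := [set o | forall x, X x -> forall s, subdiff D (g o i) x s -> enorm s <= CG i 0].
  pose Ab i := [set o | forall x, X x -> `|g o i x| <= DG i 0].
  have hg : {ae P, forall o, forall i, (Ag i `&` Ab i) o}.
    by apply: filter_forall => i; apply: filterI; [exact: hCG|exact: hDG].
  have [Om' [mOm' POm' h]] := ae_full_set (filterI hCF hg).
  by exists Om'; split => // o Oo; have [hf hgi] := h o Oo; split => // i; exact: hgi.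
pose W := Wset X DG; pose E := [set v : 'cV[R]_(n + 1 + m) | D (wx v)].
pose ph o : 'cV[R]_(n + 1 + m) -> R := phi (f o) alpha.
pose th o : 'I_m -> 'cV[R]_(n + 1 + m) -> R := theta (g o) beta.
pose Cp := Num.sqrt (CF ^+ 2 + 1) * (1 - alpha)^-1.
pose Ct i := Num.sqrt (CG i 0 ^+ 2 + 1) * (1 - beta i 0)^-1.
pose Dt i := (1 + beta i 0) / (1 - beta i 0) * DG i 0.
pose ws := mkw xs u0s us.
pose gam := gamma / Num.sqrt K%:R.
have steps k t : (1 <= k <= K)%N ->
    primal_step E W (ph (om k.*2 t)) (th (om k.*2 t)) gam (w k t) (z k t) (w k.+1 t) /\
    dual_step (th (om k.*2.+1 t)) gam (w k.+1 t) (z k t) (z k.+1 t).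
  exact: run_steps.
have sK0 : 0 < Num.sqrt (K%:R : R) by rewrite sqrtr_gt0 ltr0n.
have gam0 : 0 < gam by rewrite divr_gt0.
have cX := segment_closed_convex_set cvX.
have cW : segment_closed W by exact: segment_closed_Wset.
have WE : W `<=` E by move=> v [/XD].
have Wws : W ws by split; rewrite ?wx_mkw ?wu_mkw.
have phE o : ph o = (fun v => psi (f o) (wx v) (dotv e0 v) alpha).
  by apply/funext => v; rewrite dotv_e0.
have thE o i : th o i = (fun v => psi (g o i) (wx v) (dotv (ei i) v) (beta i 0)).
  by apply/funext => v; rewrite dotv_ei.
have iph p : W p -> P.-integrable setT (fun o => (ph o p)%:E).
  by move=> [Xp _]; exact: (psi_integrable alpha (intf _ Xp) (wu0 p)).
have ith i p : W p -> P.-integrable setT (fun o => (th o i p)%:E).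
  by move=> [Xp _]; exact: (psi_integrable (beta i 0) (intg i _ Xp) (wu p i 0)).
have ph_sub o p s : Om' o -> W p -> subdiff E (ph o) p s -> enorm s <= Cp.
  move=> /hOm'[hf _] [Xp _]; rewrite phE.
  exact: (psi_subdiff_bound alpha01 wx_e0 dotv_e0e0 (XD _ Xp) (nef o _ Xp) (hf _ Xp)).
have th_sub o i p s : Om' o -> W p -> subdiff E (th o i) p s -> enorm s <= Ct i.
  move=> /hOm'[_ /(_ i)[hg _]] [Xp _]; rewrite thE.
  exact: (psi_subdiff_bound (beta01 i) (wx_ei i) (dotv_eiei i) (XD _ Xp) (neg0 o i _ Xp)
    (hg _ Xp)).
have f_lip o x y : Om' o -> X x -> X y -> `|f o x - f o y| <= CF * enorm (x - y).
  by move=> /hOm'[hf _]; exact: (lipschitz_of_subdiff XD (nef o) hf).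
have g_lip o i x y : Om' o -> X x -> X y -> `|g o i x - g o i y| <= CG i 0 * enorm (x - y).
  by move=> /hOm'[_ /(_ i)[hg _]]; exact: (lipschitz_of_subdiff XD (neg0 o i) hg).
have ph_lip o p q : Om' o -> W p -> W q -> `|ph o p - ph o q| <= Cp * enorm (p - q).
  move=> Oo [Xp _] [Xq _]; rewrite phE.
  exact: (psi_lipschitz alpha01 wx_e0 dotv_e0e0 (f_lip o _ _ Oo Xp Xq)).
have th_lip o i p q : Om' o -> W p -> W q -> `|th o i p - th o i q| <= Ct i * enorm (p - q).
  move=> Oo [Xp _] [Xq _]; rewrite thE.
  exact: (psi_lipschitz (beta01 i) (wx_ei i) (dotv_eiei i) (g_lip o i _ _ Oo Xp Xq)).
have th_bnd o i p : Om' o -> W p -> `|th o i p| <= Dt i.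
  move=> /hOm'[_ /(_ i)[_ hb]] [Xp Up].
  exact: (psi_bound (beta01 i) (hb _ Xp) (Up i)).
have FE : F xs = mean_ph P ph ws.
  rewrite /mean_ph /ph /phi wx_mkw wu0_mkw.
  exact: (cvar_argmin alpha01 (intf _ Xxs) u0s_min).
have GE i : G i xs = mean_th P th i ws.
  rewrite /mean_th /th /theta wx_mkw wu_mkw.
  exact: (cvar_argmin (beta01 i) (intg i _ Xxs) (us_min i)).
pose Ls := F xs + \sum_(i < m) zs i 0 * G i xs.
have saddle_le z0 : nonneg z0 ->
    mean_ph P ph ws + \sum_i z0 i 0 * mean_th P th i ws <= Ls.
  move=> z00; rewrite -FE; under eq_bigr do rewrite -GE.
  by have [] := hsad xs z0 Xxs z00.
have F_le p : W p -> F (wx p) <= mean_ph P ph p.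
  by move=> [Xp _]; exact: (cvar_le_psi alpha01 (intf _ Xp)).
have G_le i p : W p -> G i (wx p) <= mean_th P th i p.
  by move=> [Xp _]; exact: (cvar_le_psi (beta01 i) (intg i _ Xp)).
have saddle_ge p : W p -> Ls <= mean_ph P ph p + \sum_i zs i 0 * mean_th P th i p.
  move=> Wp; have [_ h] := hsad (wx p) zs Wp.1 zs0; apply: le_trans h _.
  apply: lerD; first exact: F_le.
  by apply: ler_sum => i _; rewrite ler_wpM2l ?zs0// G_le.
pose zi i := zs + delta_mx i 0 : 'cV[R]_m.
have zi0 i : nonneg (zi i).
  by move=> j; rewrite !mxE addr_ge0// ?zs0//; case: (_ && _).
have zi_sum i (c : 'I_m -> R) :
    \sum_j zi i j 0 * c j = \sum_j zs j 0 * c j + c i.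
  under eq_bigr do rewrite mxE mulrDl.
  rewrite big_split/=; congr (_ + _); rewrite (bigD1 i)//= mxE !eqxx mul1r big1 ?addr0//.
  by move=> j ji; rewrite mxE (negbTE ji) mul0r.
(* Weak duality. The infimum is over a nonempty set: replacing z_star by z_star + e_i in the saddle
   inequality shows G_i(x_star) <= 0. *)
have Ls_pstar : Ls <= pstar.
  apply: lb_le_inf.
    exists (F xs), xs => //; split => // i.
    have [h _] := hsad xs (zi i) Xxs (zi0 i).
    by move: h; rewrite (zi_sum i (fun j => G j xs)); lra.
  move=> _ [x [Xx Gx] <-]; have [_ h] := hsad x zs Xx zs0; apply: le_trans h _.
  rewrite gerDl; apply: sumr_le0 => i _; rewrite mulr_ge0_le0 ?zs0//.
have P30 : 0 <= const_P3 beta CG.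
  by rewrite const_P3E// mulr_ge0// sumr_ge0// => i _; exact: sqr_ge0.
pose q := gamma ^+ 2 * const_P3 beta CG.
have q1 : q < 1 by exact: lt_sqrt_inv_sqr_mul.
have Kgam : K%:R * gam ^+ 2 = gamma ^+ 2.
  by rewrite /gam expr_div_n sqr_sqrtr ?ler0n// mulrCA divff ?mulr1// pnatr_eq0 -lt0n.
have Ct20 : 0 <= \sum_i Ct i ^+ 2 by apply: sumr_ge0 => i _; exact: sqr_ge0.
have hq : 16 * K%:R * gam ^+ 2 * (\sum_i Ct i ^+ 2) <= q.
  rewrite /q const_P3E// -Kgam -/(Ct _); set S := \sum_i Ct i ^+ 2 in Ct20 *.
  rewrite (_ : 16 * _ * _ * S = K%:R * gam ^+ 2 * (16 * S)); last by ring.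
  apply: ler_wpM2l; first by rewrite mulr_ge0 ?sqr_ge0.
  rewrite -mulrA; apply: ler_wpM2l => //.
  (* S <= m S when m >= 1; for m = 0 the sum S is empty. *)
  case: (posnP m) => [m0|m0]; last by rewrite ler_peMl// ler1n.
  by rewrite /S big1 ?mulr0// => i; have := ltn_ord i; rewrite [in X in (_ < X)%N]m0.
pose T' := good_samples om Om'.
have mT' : measurable T' by exact: (measurable_good_samples om_iid mOm').
have QT' : Q T' = 1%E by exact: (good_samples1 om_iid mOm' POm').
pose o2 := enorm (const_mx 1 + zs) ^+ 2.
have zso : enorm zs ^+ 2 <= o2.
  rewrite /o2 !enorm_sqrE; apply: ler_sum => i _; rewrite !mxE; have := zs0 i; nra.
have zio i : enorm (zi i) ^+ 2 <= o2.
  rewrite /o2 !enorm_sqrE; apply: ler_sum => j _; rewrite !mxE; have := zs0 j.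
  by case: (_ && _) => /=; nra.
have W_it k t : (1 <= k <= K.+1)%N -> W (w k t).
  by move=> hk; have [] := iterate_mem Ww1 start steps t hk.
have z_it k t : (1 <= k <= K.+1)%N -> nonneg (z k t).
  by move=> hk; have [] := iterate_mem Ww1 start steps t hk.
have eg z0 k : (1 <= k <= K)%N -> essb T' (gap P ph th w z ws z0 k).
  exact: (essb_gap om_iid mOm' POm' cW iph ith ph_sub th_sub ph_lip th_lip th_bnd gam0
    Ww1 Wws start adw adz steps).
have hk0 (k : 'I_K) : (1 <= k.+1 <= K)%N by exact: ltn_ord.
have hk1 (k : 'I_K) : (1 <= k.+2 <= K.+1)%N by exact: ltn_ord.
(* Common end of both claims: any quantity lying pathwise below the averaged gap for an admissible
   z0 has mean at most eta / sqrt K. *)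
have avg_gap z0 (Y : T -> R) : nonneg z0 -> enorm z0 ^+ 2 <= o2 -> essb T' Y ->
    (forall t, Y t <= K%:R^-1 * \sum_(k < K) gap P ph th w z ws z0 k.+1 t) ->
    \int[Q]_t Y t <= eta / Num.sqrt K%:R.
  move=> z00 z0o eY hY.
  have := sum_gap_le om_iid mOm' POm' cW WE iph ith ph_sub th_sub ph_lip th_lip th_bnd
    gam0 Ww1 Wws start adw adz steps zs0 saddle_le saddle_ge hq q1 z00 z0o zso.
  rewrite big_add1 big_mkord /= => h.
  have es : essb T' (fun t => \sum_(k < K) gap P ph th w z ws z0 k.+1 t).
    by apply: essb_sum => k; exact: eg.
  apply: le_trans (essb_le_Rintegral mT' QT' eY (essbZ K%:R^-1 es) (fun t _ => hY t)) _.
  rewrite (essb_RintegralZl mT' QT' _ es) (essb_Rintegral_sum mT' QT'); last first.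
    by move=> k; exact: eg.
  have K0' : 0 < (K%:R : R) by rewrite ltr0n.
  have g2 : 0 < 2 * gam by rewrite mulr_gt0.
  rewrite ler_pdivrMl// -(ler_pM2l g2) [leRHS]mulrCA.
  apply: le_trans h _; rewrite le_eqVlt; apply/orP; left; apply/eqP.
  have -> : K%:R * (2 * gam * (eta / Num.sqrt K%:R)) = 2 * gamma * eta.
    have := sqr_sqrtr (ltW K0'); rewrite /gam.
    move: (Num.sqrt _) sK0 => r r0 <-; field; by rewrite gt_eqF.
  have -> : 2 * gamma * eta = (const_P1 w1 ws zs + gamma ^+ 2 * const_P2 alpha CF beta DG)
      / (2 * (1 - q)).
    rewrite /eta -/q -/ws; field; by rewrite !gt_eqF ?subr_gt0.
  (* What remains is 2 K (gam^2 Dt2 + 8 gam^2 Cp^2) = gamma^2 P2, where Dt2 is the sum of the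
     squares of the [Dt i]. *)
  congr (_ * _); rewrite /const_P1 -/o2; congr (_ + _).
  have Cp2 : 16 * (CF ^+ 2 + 1) / (1 - alpha) ^+ 2 = 16 * Cp ^+ 2.
    by rewrite /Cp exprMn sqr_sqrtr ?addr_ge0 ?sqr_ge0// exprVn mulrA.
  by rewrite const_P2E// Cp2 -Kgam -/(Dt _); ring.
have xbarE t : xbar t = K%:R^-1 *: \sum_(k < K) wx (w k.+2 t).
  by rewrite /xbar big_add1 big_mkord.
have Xxbar t : X (xbar t).
  apply: (segment_closed_avg (x := fun k => wx (w k.+1 t)) cX K0) => k hk.
  exact: (W_it k.+1 t (leq_index_succ hk)).1.
have ewk k i : (1 <= k <= K.+1)%N -> essb T' (fun t => w k t i 0).
  exact: (essb_w om_iid cW ph_sub th_sub th_bnd gam0 Ww1 start adw steps).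
have exbar i : essb T' (fun t => xbar t i 0).
  under eq_fun do rewrite xbarE mxE summxE.
  apply: essbZ; apply: essb_sum => k; under eq_fun do rewrite /wx !mxE.
  exact: ewk.
have [B hB] := essb_enorm_bounded exbar.
have eF : essb T' (fun t => F (xbar t)).
  apply: (@essb_lipschitz_comp _ _ _ _ T' X F ((1 - alpha)^-1 * CF) B) => //.
  - move=> x y Xx Xy; rewrite -mulrA.
    exact: (cvar_lipschitz alpha01 mOm' POm' (intf _ Xx) (intf _ Xy)
      (fun o Oo => f_lip o x y Oo Xx Xy)).
  - by move=> i; case: (exbar i).
have eG i : essb T' (fun t => G i (xbar t)).
  apply: (@essb_lipschitz_comp _ _ _ _ T' X (G i) ((1 - beta i 0)^-1 * CG i 0) B) => //.
  - move=> x y Xx Xy; rewrite -mulrA.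
    exact: (@cvar_lipschitz _ _ _ _ P (fun o => g o i) _ (beta01 i) _ _ _ _ mOm' POm'
      (intg i _ Xx) (intg i _ Xy) (fun o Oo => g_lip o i x y Oo Xx Xy)).
  - by move=> j; case: (exbar j).
have F_avg t : F (xbar t) <= K%:R^-1 * \sum_(k < K) mean_ph P ph (w k.+2 t).
  rewrite xbarE; apply: (@cvar_avg_le _ _ _ _ _ P X D f alpha (fun k => wx (w k.+2 t))
    (fun k => wu0 (w k.+2 t)) alpha01 K0 XD intf nef).
    by move=> k; exact: (W_it k.+2 t (hk1 k)).1.
  by rewrite -xbarE.
have G_avg i t : G i (xbar t) <= K%:R^-1 * \sum_(k < K) mean_th P th i (w k.+2 t).
  rewrite xbarE; apply: (@cvar_avg_le _ _ _ _ _ P X D (fun o => g o i) (beta i 0)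
    (fun k => wx (w k.+2 t)) (fun k => wu (w k.+2 t) i 0) (beta01 i) K0 XD (intg i)
    (fun o => neg0 o i)).
    by move=> k; exact: (W_it k.+2 t (hk1 k)).1.
  by rewrite -xbarE.
have K0i : 0 < (K%:R : R)^-1 by rewrite invr_gt0 ltr0n.
have avg_cst c : K%:R^-1 * \sum_(k < K) c = c :> R.
  by rewrite sumr_const card_ord -[c *+ K]mulr_natl mulrA mulVf ?mul1r// pnatr_eq0 -lt0n.
have gap_ge (z0 : 'cV[R]_m) k t : gap P ph th w z ws z0 k t >=
    mean_ph P ph (w k.+1 t) + \sum_i z0 i 0 * mean_th P th i (w k.+1 t)
    - (mean_ph P ph ws + \sum_i z k t i 0 * mean_th P th i ws).
  by rewrite /gap sumrB; lra.
have iF := essb_integrable mT' QT' eF.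
have iG i := essb_integrable mT' QT' (eG i).
have EF : ('E_Q[fun t => F (xbar t)] = (\int[Q]_t F (xbar t))%:E)%E.
  by rewrite unlock /Rintegral fineK//; exact: integrable_fin_num iF.
have EG i : ('E_Q[fun t => G i (xbar t)] = (\int[Q]_t G i (xbar t))%:E)%E.
  by rewrite unlock /Rintegral fineK//; exact: integrable_fin_num (iG i).
split => //.
  rewrite EF -EFinB lee_fin.
  have n0 : @nonneg R m 0 by move=> i; rewrite mxE.
  have e0o : enorm (0 : 'cV[R]_m) ^+ 2 <= o2 by rewrite enorm0 expr0n/= sqr_ge0.
  have := avg_gap 0 _ n0 e0o (essbB eF (essb_cst T' pstar)).
  rewrite (essb_RintegralB mT' QT' eF (essb_cst T' pstar)) probability_Rintegral_cst.
  apply => t; rewrite lerBlDr; apply: le_trans (F_avg t) _.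
  rewrite /= -lerBlDr -[X in _ - X <= _](avg_cst pstar) -mulrBr ler_pM2l//.
  rewrite -sumrB; apply: ler_sum => k _; apply: le_trans (gap_ge _ _ _).
  (* For z0 = 0 the gap is the mean of phi at the next iterate minus L(w_star, z_k), and L(w_star,
     z_k) <= Ls <= pstar. *)
  have := saddle_le _ (z_it k.+1 t (leq_index_widen (hk0 k))).
  rewrite [X in _ + X - _]big1; last by move=> i _; rewrite mxE mul0r.
  by move: Ls_pstar; lra.
move=> i; rewrite EG lee_fin.
apply: (avg_gap (zi i) _ (zi0 i) (zio i) (eG i)) => t.
apply: le_trans (G_avg i t) _; rewrite ler_pM2l//; apply: ler_sum => k _.
(* The unit e_i isolates [mean_th i]; what is left, L(w, z_star) - L(w_star, z_k), is nonnegative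
   because Ls lies between the two values. *)
apply: le_trans (gap_ge _ _ _); rewrite zi_sum.
have := saddle_le _ (z_it k.+1 t (leq_index_widen (hk0 k))).
have := saddle_ge _ (W_it k.+2 t (hk1 k)).
lra.
Qed.
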